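(* Let $n\ge 1$ and let the coefficient ring $\mathbb{K}$ of the Hecke algebra $\mathcal{H}_n$ contain $Q^{-1}$ and the rational numbers. Then the set $\{\mathcal{N}_\lambda(1)\}_{\lambda}$, $\lambda$ running over the partitions of $n$, is a basis of the center of $\mathcal{H}_n$, and the matrix expressing it in the basis $\{\Gamma_\lambda\}$ is $E2M\cdot D$, where $D$ is the diagonal matrix with entries $Q^{n-\ell(\lambda)}$. That is, for every partition $\lambda$ of $n$, $$\mathcal{N}_\lambda(1)=\sum_{\mu\vdash n} E2M[\lambda,\mu]\,Q^{n-\ell(\mu)}\,\Gamma_\mu .$$
   Context: $\mathbb{K}$ is a commutative ring containing an invertible element $q$; $Q=q-q^{-1}$. $\mathcal{H}_n$ is the $\mathbb{K}$-algebra generated by $T_1,\dots,T_{n-1}$ with relations $T_iT_{i+1}T_i=T_{i+1}T_iT_{i+1}$, $T_iT_j=T_jT_i$ for $|i-j|>1$, and $T_i^2=QT_i+1$. For $w\in\mathfrak{S}_n$ with reduced word $s_{a_1}\cdots s_{a_l}$ ($s_i$ the transposition of $i,i+1$), $T_w=T_{a_1}\cdots T_{a_l}$; the $T_w$ form a $\mathbb{K}$-basis of $\mathcal{H}_n$. For a composition $I=[i_1,\dots,i_r]$ of $n$ (vector of positive integers of sum $n$), $\mathfrak{S}_I=\mathfrak{S}_{i_1}\times\cdots\times\mathfrak{S}_{i_r}\subset\mathfrak{S}_n$ is the Young subgroup and $\mathcal{H}(\mathfrak{S}_I)\subset\mathcal{H}_n$ the span of the $T_w$, $w\in\mathfrak{S}_I$.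 The normalization map is $$\mathcal{N}_I:\mathcal{H}(\mathfrak{S}_I)\to\mathcal{H}_n,\qquad \mathcal{N}_I(h)=\sum_{w\in\mathfrak{S}_n/\mathfrak{S}_I}T_w\,h\,T_{w^{-1}},$$ the sum being over the minimal length representatives $w$ of the left cosets $w\mathfrak{S}_I$. $\Gamma_\lambda$ ($\lambda\vdash n$) is the Geck--Rouquier basis of the center of $\mathcal{H}_n$: over $\mathbb{Z}[Q]$ with $Q$ an indeterminate, $\Gamma_\lambda$ is the unique central element which specializes at $Q=0$ to the conjugacy class sum $\mathcal{C}_\lambda=\sum_w T_w$ ($w$ of cycle type $\lambda$), and such that the expansion of $\Gamma_\lambda-\mathcal{C}_\lambda$ in the basis $T_w$ involves no $w$ which is of minimal length in its conjugacy class of $\mathfrak{S}_n$; for general $\mathbb{K}$ one takes its image under $Q\mapsto q-q^{-1}$. $\ell(\lambda)$ is the number of parts of $\lambda$. $E2M$ is the matrix, indexed by partitions of $n$, defined by $e^\lambda=\sum_\mu E2M[\lambda,\mu]\,m_\mu$, where $e^\lambda=e_{\lambda_1}e_{\lambda_2}\cdots$ are products of elementary symmetric functions and $m_\mu$ are the monomial symmetric functions. *)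

(* Defs.v *)
From HB Require Import structures.
From mathcomp Require Import all_boot all_order fingroup perm all_algebra.
From mathcomp Require Import generic_quotient mathcomp_extra boolp classical_sets.
From mathcomp Require Import mpoly.

Set Implicit Arguments.
Unset Strict Implicit.
Unset Printing Implicit Defensive.

Import GRing.Theory.
Local Open Scope ring_scope.
Local Open Scope quotient_scope.

(* The relations are parametrized by [Q] alone: the Geck-Rouquier elements live
   over Z[Q], where [Q] is an indeterminate and not of the form q - q^-1.
   The generator T_k (1 <= k < n) is indexed by k - 1 : 'I_n.-1. *)
Definition hecke_relations (R : comNzRingType) (Q : R) (n : nat)
    (A : algType R) (t : 'I_n.-1 -> A) : Prop :=
  [/\ forall i j : 'I_n.-1, j = i.+1 :> nat -> t i * t j * t i = t j * t i * t j,
      forall i j : 'I_n.-1, (i.+1 < j)%N -> t i * t j = t j * t i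
    & forall i : 'I_n.-1, t i * t i = Q *: t i + 1].

Inductive hterm (R : Type) (n : nat) : Type :=
  | HGen of 'I_n.-1
  | HScal of R
  | HAdd of hterm R n & hterm R n
  | HMul of hterm R n & hterm R n.

Arguments HGen {R n}.
Arguments HScal {R n}.

(* The least congruence making terms an R-algebra, with [HScal a] standing for
   the scalar a, in which the Hecke relations hold. *)
Inductive heq (R : comNzRingType) (Q : R) (n : nat) :
    hterm R n -> hterm R n -> Prop :=
  | heq_refl x : heq Q x x
  | heq_sym x y : heq Q x y -> heq Q y x
  | heq_trans y x z : heq Q x y -> heq Q y z -> heq Q x z
  | heq_add x x' y y' : heq Q x x' -> heq Q y y' -> heq Q (HAdd x y) (HAdd x' y')
  | heq_mul x x' y y' : heq Q x x' -> heq Q y y' -> heq Q (HMul x y) (HMul x' y')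
  | heq_addA x y z : heq Q (HAdd x (HAdd y z)) (HAdd (HAdd x y) z)
  | heq_addC x y : heq Q (HAdd x y) (HAdd y x)
  | heq_add0 x : heq Q (HAdd (HScal 0) x) x
  | heq_addN x : heq Q (HAdd (HMul (HScal (-1)) x) x) (HScal 0)
  | heq_mulA x y z : heq Q (HMul x (HMul y z)) (HMul (HMul x y) z)
  | heq_mul1l x : heq Q (HMul (HScal 1) x) x
  | heq_mulDl x y z : heq Q (HMul (HAdd x y) z) (HAdd (HMul x z) (HMul y z))
  | heq_mulDr x y z : heq Q (HMul x (HAdd y z)) (HAdd (HMul x y) (HMul x z))
  | heq_scalC a x : heq Q (HMul (HScal a) x) (HMul x (HScal a))
  | heq_scalD a b : heq Q (HScal (a + b)) (HAdd (HScal a) (HScal b))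
  | heq_scalM a b : heq Q (HScal (a * b)) (HMul (HScal a) (HScal b))
  | heq_braid (i j : 'I_n.-1) : j = i.+1 :> nat ->
      heq Q (HMul (HMul (HGen i) (HGen j)) (HGen i))
            (HMul (HMul (HGen j) (HGen i)) (HGen j))
  | heq_comm (i j : 'I_n.-1) : (i.+1 < j)%N ->
      heq Q (HMul (HGen i) (HGen j)) (HMul (HGen j) (HGen i))
  | heq_quad i :
      heq Q (HMul (HGen i) (HGen i)) (HAdd (HMul (HScal Q) (HGen i)) (HScal 1)).

HB.instance Definition _ (R : Type) (n : nat) := gen_eqMixin (hterm R n).
HB.instance Definition _ (R : Type) (n : nat) := gen_choiceMixin (hterm R n).

Section HeckeQuotient.
Variables (R : comNzRingType) (Q : R) (n : nat).

Definition heqb : rel (hterm R n) := fun x y => `[< heq Q x y >].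

Lemma heqb_class : equiv_class_of heqb.
Proof.
split.
- by move=> x; apply/asboolP/heq_refl.
- by move=> x y; apply/asboolP/asboolP; apply: heq_sym.
- by move=> y x z /asboolP xy /asboolP yz; apply/asboolP/(heq_trans xy yz).
Qed.

Canonical heqb_equiv := EquivRelPack heqb_class.

Definition hecke : Type := {eq_quot heqb_equiv}.
HB.instance Definition _ := Choice.on hecke.
HB.instance Definition _ := EqQuotient.on hecke.

End HeckeQuotient.

Section HeckeEval.
Variables (R S : comNzRingType) (f : R -> S) (n : nat) (A : algType S).
Variable t : 'I_n.-1 -> A.

Fixpoint heval (x : hterm R n) : A :=
  match x with
  | HGen i => t i
  | HScal a => (f a)%:A
  | HAdd x y => heval x + heval y
  | HMul x y => heval x * heval y
  end.

End HeckeEval.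

Lemma heval_heq (R S : comNzRingType) (f : {rmorphism R -> S}) (Q : R) (n : nat)
    (A : algType S) (t : 'I_n.-1 -> A) (x y : hterm R n) :
  hecke_relations (f Q) t -> heq Q x y -> heval f t x = heval f t y.
Proof.
case=> tbraid tcomm tquad; elim=> {x y} /=.
- by [].
- by [].
- by move=> y x z _ -> _ ->.
- by move=> x x' y y' _ -> _ ->.
- by move=> x x' y y' _ -> _ ->.
- by move=> *; rewrite addrA.
- by move=> *; rewrite addrC.
- by move=> x; rewrite rmorph0 scale0r add0r.
- by move=> x; rewrite rmorphN1 rmorph0 scaleN1r scale0r mulN1r addNr.
- by move=> *; rewrite mulrA.
- by move=> x; rewrite rmorph1 scale1r mul1r.
- by move=> *; rewrite mulrDl.
- by move=> *; rewrite mulrDr.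
- by move=> a x; rewrite mulr_algl mulr_algr.
- by move=> a b; rewrite rmorphD scalerDl.
- by move=> a b; rewrite rmorphM mulr_algl scalerA.
- by move=> i j /tbraid.
- by move=> i j /tcomm.
- by move=> i; rewrite rmorph1 scale1r mulr_algl tquad.
Qed.

Section HeckeRing.
Variables (R : comNzRingType) (Q : R) (n : nat).
Local Notation H := (hecke Q n).
Local Notation hpi := (\pi_(hecke Q n)).

Lemma hpiP (x y : hterm R n) : hpi x = hpi y <-> heq Q x y.
Proof.
by split=> [/eqquotP/asboolP //|xy]; apply/eqquotP/asboolP.
Qed.

Lemma hreprP (x : hterm R n) : heq Q (repr (hpi x)) x.
Proof. by apply/hpiP; rewrite reprK. Qed.

Definition hadd (x y : H) : H := hpi (HAdd (repr x) (repr y)).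
Definition hmul (x y : H) : H := hpi (HMul (repr x) (repr y)).
Definition hscal (a : R) : H := hpi (HScal a).

Lemma haddE x y : hadd (hpi x) (hpi y) = hpi (HAdd x y).
Proof. by apply/hpiP/heq_add; apply: hreprP. Qed.

Lemma hmulE x y : hmul (hpi x) (hpi y) = hpi (HMul x y).
Proof. by apply/hpiP/heq_mul; apply: hreprP. Qed.

Lemma hpi_surj (x : H) : {u | x = hpi u}.
Proof. by exists (repr x); rewrite reprK. Qed.

Local Ltac lift x := let u := fresh "u" in have [u ->] := hpi_surj x.

Lemma haddA : associative hadd.
Proof.
move=> x y z; lift x; lift y; lift z; rewrite ?(haddE, hmulE).
exact/hpiP/heq_addA.
Qed.

Lemma haddC : commutative hadd.
Proof. by move=> x y; lift x; lift y; rewrite ?(haddE, hmulE); apply/hpiP/heq_addC. Qed.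

Lemma hadd0 : left_id (hscal 0) hadd.
Proof. by move=> x; lift x; rewrite ?(haddE, hmulE); apply/hpiP/heq_add0. Qed.

Lemma hmulA : associative hmul.
Proof.
move=> x y z; lift x; lift y; lift z; rewrite ?(haddE, hmulE).
exact/hpiP/heq_mulA.
Qed.

Lemma hscalC a x : hmul (hscal a) x = hmul x (hscal a).
Proof. by lift x; rewrite ?(haddE, hmulE); apply/hpiP/heq_scalC. Qed.

Lemma hscalD a b : hscal (a + b) = hadd (hscal a) (hscal b).
Proof. by rewrite ?(haddE, hmulE); apply/hpiP/heq_scalD. Qed.

Lemma hscalM a b : hscal (a * b) = hmul (hscal a) (hscal b).
Proof. by rewrite ?(haddE, hmulE); apply/hpiP/heq_scalM. Qed.

Lemma hmul1l : left_id (hscal 1) hmul.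
Proof. by move=> x; lift x; rewrite ?(haddE, hmulE); apply/hpiP/heq_mul1l. Qed.

Lemma hmul1r : right_id (hscal 1) hmul.
Proof. by move=> x; rewrite -hscalC hmul1l. Qed.

Lemma hmulDl : left_distributive hmul hadd.
Proof.
move=> x y z; lift x; lift y; lift z; rewrite ?(haddE, hmulE).
exact/hpiP/heq_mulDl.
Qed.

Lemma hmulDr : right_distributive hmul hadd.
Proof.
move=> x y z; lift x; lift y; lift z; rewrite ?(haddE, hmulE).
exact/hpiP/heq_mulDr.
Qed.

Definition hopp (x : H) : H := hmul (hscal (-1)) x.

Lemma haddN : left_inverse (hscal 0) hopp hadd.
Proof. by move=> x; lift x; rewrite /hopp hmulE haddE; apply/hpiP/heq_addN. Qed.

HB.instance Definition _ := GRing.isZmodule.Build H haddA haddC hadd0 haddN.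

Lemma hecke_nontrivial : hscal 1 != hscal 0.
Proof.
pose C : 'M[R]_2 :=
  \matrix_(i, j) if i == j then Q *+ (i == 1) else 1.
have CC : C * C = Q *: C + 1.
  apply/matrixP=> i j; rewrite -[C * C]/(C *m C) !mxE big_ord_recl big_ord1 !mxE.
  case: i => [[|[|//]]] ?; case: j => [[|[|//]]] ? /=;
    rewrite ?eqE /= ?mulr1n ?mulr0n ?mulr0 ?mul0r ?add0r ?addr0 ?mulr1 ?mul1r //.
  by rewrite addrC.
have rels : @hecke_relations R Q n _ (fun=> C) by split.
apply/eqP => /hpiP /(@heval_heq R R idfun Q n _ (fun=> C) _ _ rels) /=.
by rewrite scale1r scale0r => /eqP; rewrite oner_eq0.
Qed.

HB.instance Definition _ := GRing.Zmodule_isNzRing.Build H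
  hmulA hmul1l hmul1r hmulDl hmulDr hecke_nontrivial.

Definition hscale (a : R) (x : H) : H := hscal a * x.

Lemma hscaleA a b x : hscale a (hscale b x) = hscale (a * b) x.
Proof. by rewrite /hscale mulrA [in RHS]hscalM. Qed.

Lemma hscale1 : left_id 1 hscale.
Proof. exact: hmul1l. Qed.

Lemma hscaleDr : right_distributive hscale +%R.
Proof. by move=> a x y; apply: mulrDr. Qed.

Lemma hscaleDl x : {morph hscale^~ x : a b / a + b}.
Proof. by move=> a b; rewrite /hscale [in LHS]hscalD -mulrDl. Qed.

HB.instance Definition _ := GRing.Zmodule_isLmodule.Build R H
  hscaleA hscale1 hscaleDr hscaleDl.

Lemma hscaleAl a (x y : H) : a *: (x * y) = (a *: x) * y.
Proof. exact: mulrA. Qed.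

HB.instance Definition _ := GRing.Lmodule_isLalgebra.Build R H hscaleAl.

Lemma hscaleAr a (x y : H) : a *: (x * y) = x * (a *: y).
Proof.
rewrite -[LHS]/(hscal a * (x * y)) -[RHS]/(x * (hscal a * y)).
by rewrite !mulrA -[hscal a * x]/(hmul _ _) hscalC.
Qed.

HB.instance Definition _ := GRing.Lalgebra_isAlgebra.Build R H hscaleAr.

Definition hgen (i : 'I_n.-1) : H := hpi (HGen i).

Lemma hgen_relations : hecke_relations Q hgen.
Proof.
have mE x y : hpi x * hpi y = hpi (HMul x y) := hmulE x y.
have aE x y : hpi x + hpi y = hpi (HAdd x y) := haddE x y.
have sE a x : a *: hpi x = hpi (HMul (HScal a) x) := hmulE _ x.
have oE : 1 = hpi (HScal 1) by [].
split=> [i j ij|i j ij|i]; rewrite /hgen.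
- rewrite (mE (HGen i) (HGen j)) (mE (HMul _ _) (HGen i)).
  rewrite (mE (HGen j) (HGen i)) (mE (HMul _ _) (HGen j)).
  exact/hpiP/heq_braid.
- by rewrite (mE (HGen i) (HGen j)) (mE (HGen j) (HGen i)); apply/hpiP/heq_comm.
- rewrite (mE (HGen i) (HGen i)) (sE Q (HGen i)) oE (aE (HMul _ _) (HScal 1)).
  exact/hpiP/heq_quad.
Qed.

End HeckeRing.

Arguments hgen {R} Q {n} i.

(* The map sending each [hgen Q i] to [t i] and acting as [f] on scalars. *)
Definition hlift (R S : comNzRingType) (f : R -> S) (Q : R) (n : nat)
    (A : algType S) (t : 'I_n.-1 -> A) (x : hecke Q n) : A :=
  heval f t (repr x).

(* With f = idfun this is the universal property of the presentation. *)
Lemma hlift_unique (R S : comNzRingType) (f : {rmorphism R -> S}) (Q : R)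
    (n : nat) (A : algType S) (t : 'I_n.-1 -> A) (g : hecke Q n -> A) :
  hecke_relations (f Q) t ->
  [/\ {morph g : x y / x + y}, {morph g : x y / x * y},
      forall a, g a%:A = (f a)%:A & forall i, g (hgen Q i) = t i]
  <-> g =1 hlift f t.
Proof.
move=> tQ.
have pE u : hlift f t (\pi_(hecke Q n) u) = heval f t u.
  exact: heval_heq tQ (hreprP Q u).
have aE a : a%:A = hscal Q n a by exact: mulr1.
split=> [[gD gM gS gt] x|gE].
  rewrite -[x]reprK pE; elim: (repr x) => {x} //= [a|x <- y <-|x <- y <-].
  - by rewrite -gS aE.
  - by rewrite -gD; congr g; rewrite -[RHS]/(hadd _ _) haddE.
  - by rewrite -gM; congr g; rewrite -[RHS]/(hmul _ _) hmulE.
by split=> [x y|x y|a|i]; rewrite !gE ?aE ?pE.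
Qed.

(* Change of coefficients along f : R -> S, for f Q = Q'. *)
Definition hmap (R S : comNzRingType) (f : R -> S) (Q : R) (Q' : S) (n : nat) :
    hecke Q n -> hecke Q' n :=
  hlift f (hgen Q').

Definition hcentral (R : comNzRingType) (Q : R) (n : nat) (z : hecke Q n) : Prop :=
  forall h : hecke Q n, z * h = h * z.

(* [b] is an R-basis of the submodule [P] of [V]. *)
Definition basis_of_submodule (R : comNzRingType) (V : lmodType R) (P : V -> Prop)
    (I : finType) (b : I -> V) : Prop :=
  (forall i, P (b i)) /\
  (forall z, P z -> exists! c : {ffun I -> R}, z = \sum_i c i *: b i).

Section Simple.
Variable n : nat.

Lemma simple_lo_proof (i : 'I_n.-1) : (i < n)%N.
Proof. by case: n i => [|m] [i] //= /ltnW. Qed.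

Lemma simple_hi_proof (i : 'I_n.-1) : (i.+1 < n)%N.
Proof. by case: n i => [|m] [i]. Qed.

Definition simple_refl (i : 'I_n.-1) : 'S_n :=
  tperm (Ordinal (simple_lo_proof i)) (Ordinal (simple_hi_proof i)).

Definition word_prod (a : seq 'I_n.-1) : 'S_n := (\prod_(i <- a) simple_refl i)%g.

Lemma word_exists (w : 'S_n) : exists a, word_prod a == w.
Proof.
suff tperm_word (d : nat) (x y : 'I_n) : y = (x + d)%N :> nat ->
    exists a, word_prod a = tperm x y.
  have [ts -> _] := prod_tpermP w.
  elim: ts => [|[x y] ts [a /eqP aE]]; first by exists [::]; rewrite /word_prod !big_nil.
  have [b bE] : exists b, word_prod b = tperm x y.
    case: (leqP x y) => [|/ltnW] /subnKC xy.
      exact: (tperm_word (y - x)%N).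
    by rewrite tpermC; apply: (tperm_word (x - y)%N).
  exists (b ++ a); rewrite big_cons /= -bE -aE.
  by rewrite /word_prod big_cat.
elim: d x y => [|d IHd] x y yE.
  exists [::]; rewrite /word_prod big_nil.
  have -> : y = x by apply: val_inj; rewrite /= yE addn0.
  by rewrite tperm1.
have xd : (x + d < n.-1)%N.
  by have := ltn_ord y; rewrite yE addnS ltn_predRL.
pose i := Ordinal xd.
have hiE : Ordinal (simple_hi_proof i) = y.
  by apply: val_inj; rewrite /= yE addnS.
case: d => [|d] in IHd yE xd i hiE *.
  exists [:: i]; rewrite /word_prod big_seq1 /simple_refl hiE; congr tperm.
  by apply: val_inj; rewrite /= addn0.
have [a aE] := IHd x (Ordinal (simple_lo_proof i)) erefl.
exists (i :: a ++ [:: i]).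
have -> : tperm x y = (tperm x (Ordinal (simple_lo_proof i)) ^ simple_refl i)%g.
  rewrite tpermJ /simple_refl hiE tpermL tpermD //.
    by rewrite -val_eqE /= -[X in _ != X]addn0 eqn_add2l.
  by rewrite -val_eqE /= yE -[X in _ != X]addn0 eqn_add2l.
rewrite /word_prod big_cons big_cat big_seq1 /= -/(word_prod a) aE.
by rewrite /conjg /simple_refl tpermV mulgA.
Qed.

Lemma word_length_exists (w : 'S_n) :
  exists k, [exists a : k.-tuple 'I_n.-1, word_prod a == w].
Proof.
by have [a aw] := word_exists w; exists (size a); apply/existsP; exists (in_tuple a).
Qed.

Definition perm_length (w : 'S_n) : nat := ex_minn (word_length_exists w).

Lemma reduced_word_exists (w : 'S_n) :
  exists a : (perm_length w).-tuple 'I_n.-1, word_prod a == w.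
Proof. by rewrite /perm_length; case: ex_minnP => k /existsP. Qed.

Definition reduced_word (w : 'S_n) : seq 'I_n.-1 := xchoose (reduced_word_exists w).

End Simple.

(* T_w does not depend on the reduced word chosen. *)
Definition hT (R : comNzRingType) (Q : R) (n : nat) (w : 'S_n) : hecke Q n :=
  \prod_(i <- reduced_word w) hgen Q i.

(* Blocks of consecutive integers of sizes I_1, I_2, ... are the fibres of
   [reshape_index I]; [I] is meant to have sum [n]. *)
Definition young (n : nat) (I : seq nat) : {set 'S_n} :=
  [set w : 'S_n | [forall i, reshape_index I (w i) == reshape_index I i]].

Definition min_coset_rep (n : nat) (I : seq nat) (w : 'S_n) : bool :=
  [forall u in young n I, (perm_length w <= perm_length (w * u)%g)%N].

(* The normalization map, extended by the same formula from the subalgebra of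
   the Young subgroup to the whole Hecke algebra. *)
Definition normalization (R : comNzRingType) (Q : R) (n : nat) (I : seq nat)
    (h : hecke Q n) : hecke Q n :=
  \sum_(w : 'S_n | min_coset_rep I w) hT Q w * h * hT Q w^-1%g.

Definition is_partition (n : nat) (s : seq nat) : bool :=
  [&& sorted geq s, all (leq 1) s & sumn s == n].

Record partition_of (n : nat) : Type :=
  PartitionOf { parts :> seq nat; partsP : is_partition n parts }.

HB.instance Definition _ n := [isSub for @parts n].
HB.instance Definition _ n := [Countable of partition_of n by <:].

Section PartitionFinite.
Variable n : nat.

Lemma size_partition (p : partition_of n) : (size p <= n)%N.
Proof.
case: p => s /= /and3P[_ s1 /eqP<-].
by elim: s s1 => //= x s IHs /andP[x1 /IHs]; rewrite -add1n; apply: leq_add.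
Qed.

Lemma part_le (p : partition_of n) (k : nat) : k \in parts p -> (k <= n)%N.
Proof.
case: p => s /= /and3P[_ _ /eqP<-].
elim: s => //= x s IHs; rewrite inE => /orP[/eqP->|/IHs]; first exact: leq_addr.
by move=> ks; apply: leq_trans ks (leq_addl _ _).
Qed.

Definition partition_enum : seq (partition_of n) :=
  pmap (fun s : n.-bseq 'I_n.+1 => insub [seq val i | i <- s]) (enum {: n.-bseq 'I_n.+1}).

Lemma partition_enumP : Finite.axiom (undup partition_enum).
Proof.
apply: Finite.uniq_enumP; first exact: undup_uniq.
move=> p; rewrite mem_undup inE mem_pmap; apply/mapP.
have sz : (size [seq (inord k : 'I_n.+1) | k <- parts p] <= n)%N.
  by rewrite size_map size_partition.
exists (Bseq sz); first by rewrite mem_enum.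
rewrite -map_comp map_id_in ?valK // => k kp /=.
by rewrite inordK // ltnS (part_le kp).
Qed.

HB.instance Definition _ := isFinite.Build (partition_of n) partition_enumP.

End PartitionFinite.

Definition cycle_type (n : nat) (w : 'S_n) : seq nat :=
  sort geq [seq #|c| | c : {set 'I_n} in porbits w].

Definition class_sum (R : comNzRingType) (Q : R) (n : nat) (la : partition_of n) :
    hecke Q n :=
  \sum_(w : 'S_n | cycle_type w == la) hT Q w.

Definition min_in_class (n : nat) (w : 'S_n) : bool :=
  [forall u : 'S_n, (perm_length w <= perm_length (w ^ u)%g)%N].

(* Here ['X : {poly int}] is the indeterminate Q. *)
Definition is_geck_rouquier (n : nat) (la : partition_of n)
    (g : hecke ('X : {poly int}) n) : Prop :=
  [/\ hcentral g,
      hmap (fun p : {poly int} => p.[0]) (0 : int) g = class_sum (0 : int) la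
    & exists c : 'S_n -> {poly int},
        g - class_sum ('X : {poly int}) la = \sum_(w : 'S_n) c w *: hT 'X w
        /\ forall w, min_in_class w -> c w = 0].

(* The element characterized above exists and is unique (Geck-Rouquier), so the
   default value of [xget] is never used. *)
Definition geck_rouquier_generic (n : nat) (la : partition_of n) :
    hecke ('X : {poly int}) n :=
  xget 0 (is_geck_rouquier la).

Definition geck_rouquier (R : comNzRingType) (Q : R) (n : nat)
    (la : partition_of n) : hecke Q n :=
  hmap (fun p : {poly int} => (map_poly intr p).[Q]) Q (geck_rouquier_generic la).

(* Symmetric functions of degree n are determined by their restriction to n
   variables. *)
Definition elementary_prod (n : nat) (la : partition_of n) : {mpoly int[n]} :=
  \prod_(k <- la) mesym n int k.

Definition exponents (n : nat) (m : 'X_{1..n}) : seq nat :=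
  sort geq [seq k <- [seq m i | i : 'I_n] | (0 < k)%N].

Definition monomial_sym (n : nat) (mu : partition_of n) : {mpoly int[n]} :=
  \sum_(m : 'X_{1..n < n.+1} | exponents m == mu) 'X_[m].

Definition is_E2M (n : nat) (M : partition_of n -> partition_of n -> int) : Prop :=
  forall la, elementary_prod la = \sum_mu M la mu *: monomial_sym mu.

Definition E2M (n : nat) : partition_of n -> partition_of n -> int :=
  xget (fun _ _ => 0) (@is_E2M n).

Lemma elementary_prod_sym n (la : partition_of n) : elementary_prod la \is symmetric.
Proof.
apply: (big_ind (fun p : {mpoly int[n]} => p \is symmetric)).
- exact: rpred1.
- exact: rpredM.
- by move=> k _; apply: mesym_sym.
Qed.

Lemma elementary_prod_homog n (la : partition_of n) : elementary_prod la \is n.-homog.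
Proof.
rewrite /elementary_prod; case: la => s /= /and3P[_ _ /eqP sn].
rewrite -[X in X.-homog]sn {sn}.
elim: s => [|k s IHs]; first by rewrite big_nil dhomog1.
by rewrite big_cons /= dhomogM ?dhomog_mesym.
Qed.

Lemma mdeg_exponents n (m : 'X_{1..n}) : mdeg m = sumn (exponents m).
Proof.
have -> : sumn (exponents m) = sumn [seq k <- [seq m i | i : 'I_n] | (0 < k)%N].
  by apply/perm_sumn; rewrite perm_sort.
rewrite sumnE big_filter big_map big_enum_cond /= mdegE [RHS]big_mkcond /=.
by apply: eq_bigr => i _; case: (m i).
Qed.

Lemma exponents_partition n (m : 'X_{1..n}) :
  mdeg m = n -> is_partition n (exponents m).
Proof.
move=> mn; apply/and3P; split.
- by apply: sort_sorted => x y; apply: leq_total.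
- by apply/allP=> k; rewrite mem_sort mem_filter => /andP[].
- by rewrite -mdeg_exponents mn.
Qed.

Lemma perm_exponents n (m : 'X_{1..n}) :
  perm_eq [seq m i | i : 'I_n] (exponents m ++ nseq (n - size (exponents m)) 0%N).
Proof.
have /permPl := perm_filterC (leq 1) [seq m i | i : 'I_n].
rewrite perm_sym => /perm_trans; apply; rewrite perm_cat //.
  by rewrite perm_sym perm_sort.
have -> : (n - size (exponents m) = count (predC (leq 1)) [seq m i | i : 'I_n])%N.
  rewrite -[X in (X - _)%N](_ : size [seq m i | i : 'I_n] = n); last first.
    by rewrite size_map size_enum_ord.
  by rewrite -(count_predC (leq 1)) size_sort size_filter addKn.
rewrite -size_filter; set z := filter _ _.
suff /all_pred1P <- : all (pred1 0%N) z by [].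
by apply/allP=> -[|k] //; rewrite mem_filter.
Qed.

Lemma exponents_perm n (m m' : 'X_{1..n}) :
  exponents m = exponents m' -> exists s : 'S_n, m' = [multinom m (s i) | i < n].
Proof.
move=> mm'.
have /tuple_permP[s sE] : perm_eq [tuple m' i | i < n] [tuple m i | i < n].
  have tE (a : 'X_{1..n}) : [tuple a i | i < n] = [seq a i | i : 'I_n] :> seq nat by [].
  rewrite !tE (permPl (perm_exponents m')) -mm' perm_sym.
  exact: perm_exponents.
exists s; apply/mnmP=> i; rewrite mnmE.
have := congr1 (fun t => nth 0%N t i) sE.
by rewrite -!tnth_nth !tnth_mktuple.
Qed.

Definition partition_mnm n (mu : partition_of n) : 'X_{1..n} :=
  [multinom nth 0%N mu i | i < n].

Lemma exponents_mnm n (mu : partition_of n) : exponents (partition_mnm mu) = mu.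
Proof.
have gt : transitive geq by move=> y x z /= xy yz; apply: leq_trans yz xy.
have ga : antisymmetric geq by move=> x y; rewrite andbC => /anti_leq.
have /and3P[mus mu1 _] := partsP mu.
apply: (sorted_eq gt ga _ mus).
  by apply: sort_sorted => x y; apply: leq_total.
rewrite perm_sort.
have -> : [seq partition_mnm mu i | i : 'I_n] = mu ++ nseq (n - size mu) 0%N.
  apply: (@eq_from_nth _ 0%N).
    by rewrite size_map size_enum_ord size_cat size_nseq subnKC ?size_partition.
  move=> k; rewrite size_map size_enum_ord => kn.
  rewrite (nth_map (Ordinal kn)) ?size_enum_ord // mnmE nth_enum_ord //.
  rewrite nth_cat nth_nseq if_same; case: ltnP => // /(nth_default 0%N) //.
rewrite filter_cat (all_filterP mu1) filter_nseq /= cats0.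
exact: perm_refl.
Qed.

Lemma mcoeff_monomial_sym n (mu : partition_of n) (m : 'X_{1..n}) :
  (monomial_sym mu)@_m = (exponents m == mu)%:R.
Proof.
rewrite /monomial_sym raddf_sum /=.
have [mn|mn] := eqVneq (mdeg m) n; last first.
  rewrite big1 => [|m' /eqP m'mu].
    case: eqP => // mmu; case/eqP: mn.
    by rewrite mdeg_exponents mmu; case/and3P: (partsP mu) => _ _ /eqP.
  rewrite mcoeffX; case: eqP => // m'm; case/eqP: mn.
  by rewrite -m'm mdeg_exponents m'mu; case/and3P: (partsP mu) => _ _ /eqP.
have mb : (mdeg m < n.+1)%N by rewrite mn.
rewrite big_mkcond (bigD1 (BMultinom mb)) //= big1 ?addr0.
  by rewrite mcoeffX eqxx; case: ifP.
move=> m' m'm; case: ifP => // _; rewrite mcoeffX.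
by rewrite -[_ == m]/(_ == bmnm (BMultinom mb)) (inj_eq val_inj) (negPf m'm).
Qed.

Lemma E2MP n : is_E2M (@E2M n).
Proof.
apply: xgetPex; exists (fun la mu => (elementary_prod la)@_(partition_mnm mu)) => la.
apply/mpolyP=> m; rewrite raddf_sum /=.
under eq_bigr do rewrite mcoeffZ mcoeff_monomial_sym.
have [mn|mn] := eqVneq (mdeg m) n; last first.
  rewrite (dhomog_nemf_coeff (elementary_prod_homog la) mn) big1 // => mu _.
  case: eqP => [mmu|]; last by rewrite mulr0.
  case/eqP: mn.
  by rewrite mdeg_exponents mmu; case/and3P: (partsP mu) => _ _ /eqP.
pose mu := PartitionOf (exponents_partition mn).
rewrite (bigD1 mu) //= eqxx mulr1 big1 ?addr0 => [|nu]; last first.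
  by rewrite eq_sym -val_eqE /= => /negPf->; rewrite mulr0.
have [|s ->] := @exponents_perm n m (partition_mnm mu).
  by rewrite exponents_mnm.
by rewrite msym_coeff ?elementary_prod_sym.
Qed.

(* Main.v *)
Require Import Defs.
From mathcomp Require Import all_boot all_order fingroup perm all_algebra.
From mathcomp Require Import generic_quotient mpoly zify ring.
From mathcomp Require classical_sets.

(* Write t_z(h) = tau(z h), where tau(h) is the coefficient of T_1 in h. As
   tau(T_x T_y) = [x y = 1], t_z determines z, and it is a trace when z is
   central. Since H_(k+1) = H_k + H_k T_k H_k, where H_k is generated by the T_i
   with i < k and commutes with T_(k+1), T_(k+2), ..., a trace on H_n is
   determined by its values on the products of pairwise distinct generators;
   cyclic rotations and the conjugation by block-swapping permutations identify
   such products when their letters define compositions with the same parts.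
   So a central element is determined by one coefficient per partition, namely
   the one of the elements of minimal length in the class.

   For central z = N_la(1) and d a product of distinct generators, t_z(T_d) is
   the sum of the coefficients of T_x in T_d T_x over minimal coset
   representatives x, which is Q^|d| if all the letters of d are descents of x,
   and 0 otherwise. The x that descend along the blocks of mu correspond to the
   0-1 matrices with row sums la and column sums mu, counted by E2M[la, mu].

   Inverting E2M over Z[Q], up to its determinant, then yields the
   Geck-Rouquier elements: divisibility of the minimal length coefficients
   passes to all the coefficients. *)

Set Implicit Arguments.
Unset Strict Implicit.
Unset Printing Implicit Defensive.

Import GRing.Theory.
Local Open Scope ring_scope.

(** * Inversions and reduced words *)

(** The algebra is given by generators and relations only, so the freeness of the [hT Q w], without
    which tau has no meaning, must be established: the generators act on functions on the symmetric
    group by the rule that coefficients in a basis would obey, and the coefficients of an element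
    are read off its action on the indicator function of 1. The condition defining the Geck-Rouquier
    elements prescribes their coefficients on elements of minimal length in their class, hence makes
    them dual to the evaluations at partitions ([central_value]). This is why the coefficient of
    Gamma_mu in N_la(1) is the value of N_la(1) at mu. As these elements are picked by [xget], their
    existence is part of the proof. E2M is inverted only through a nonzero determinant, which comes
    from the algebraic independence of the elementary symmetric polynomials; this determinant is
    invertible in K because K receives the rationals. Products of permutations apply the left factor
    first: left multiplication by [s i] acts on positions, right multiplication on values. *)

Section Perm.
Variable n : nat.
Implicit Types (i j : 'I_n.-1) (x w : 'S_n) (a : seq 'I_n.-1).

Definition lo i : 'I_n := Ordinal (simple_lo_proof i).
Definition hi i : 'I_n := Ordinal (simple_hi_proof i).
Local Notation s := (@simple_refl n).

Lemma simple_reflE i : s i = tperm (lo i) (hi i). Proof. by []. Qed.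

Lemma lo_neq_hi i : lo i != hi i.
Proof. by rewrite -val_eqE /= ltn_eqF. Qed.

Lemma simple_refl_lo i : s i (lo i) = hi i. Proof. exact: tpermL. Qed.
Lemma simple_refl_hi i : s i (hi i) = lo i. Proof. exact: tpermR. Qed.

Lemma simple_refl_id i (k : 'I_n) : k != i :> nat -> k != i.+1 :> nat -> s i k = k.
Proof. by move=> ki kSi; apply: tpermD; rewrite eq_sym -val_eqE. Qed.

Lemma simple_reflK i : involutive (s i).
Proof. exact: tpermK. Qed.

Lemma simple_refl2 i : (s i * s i = 1)%g.
Proof. exact: tperm2. Qed.

Lemma simple_reflV i : ((s i)^-1 = s i)%g.
Proof. exact: tpermV. Qed.

Lemma mulsKg i x : (s i * (s i * x) = x)%g.
Proof. by rewrite mulgA simple_refl2 mul1g. Qed.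

Lemma mulgKs i x : (x * s i * s i = x)%g.
Proof. by rewrite -mulgA simple_refl2 mulg1. Qed.

Lemma simple_refl_comm i j : (i.+1 < j)%N -> (s i * s j = s j * s i)%g.
Proof.
move=> ij; apply/permP=> k; rewrite !permM.
have [ki|ki] := eqVneq (k : nat) i; last have [kj|kj] := eqVneq (k : nat) i.+1.
- have -> : k = lo i by apply: val_inj.
  by rewrite simple_refl_lo !(@simple_refl_id j) ?simple_refl_lo //=; lia.
- have -> : k = hi i by apply: val_inj.
  by rewrite simple_refl_hi !(@simple_refl_id j) ?simple_refl_hi //=; lia.
rewrite [s i k]simple_refl_id // [RHS]simple_refl_id //.
all: have [kj'|kj'] := eqVneq (k : nat) j; last have [kSj|kSj] := eqVneq (k : nat) j.+1.
1,4: have -> : k = lo j by apply: val_inj.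
1,2: by rewrite simple_refl_lo /=; lia.
1,3: have -> : k = hi j by apply: val_inj.
1,2: by rewrite simple_refl_hi /=; lia.
all: by rewrite simple_refl_id //; lia.
Qed.

Lemma simple_refl_braid i j : j = i.+1 :> nat -> (s i * s j * s i = s j * s i * s j)%g.
Proof.
move=> ij; have hilo : hi i = lo j by apply: val_inj; rewrite /= ij.
have lohi : lo i != hi j by rewrite -val_eqE /= ij; lia.
have aux (a b c : 'I_n) : a != b -> b != c -> a != c ->
   (tperm a b * tperm b c * tperm a b = tperm a c)%g /\
   (tperm b c * tperm a b * tperm b c = tperm a c)%g.
  move=> ab bc ac; have E (p q : 'S_n) : (p^-1 = p -> p * q * p = q ^ p)%g.
    by move=> pV; rewrite conjgE pV mulgA.
  rewrite !E ?tpermV // !tpermJ !tpermL !tpermR.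
  by rewrite [tperm a b c]tpermD // [tperm b c a]tpermD // 1?eq_sym.
rewrite !simple_reflE hilo; have [|||-> ->] := aux (lo i) (lo j) (hi j) => //.
- by rewrite -hilo lo_neq_hi.
- exact: lo_neq_hi.
Qed.

Definition ldescent i x : bool := (x (hi i) < x (lo i))%N.

(** Values of a permutation are chained upwards with [ltn], block numbers downwards with [gtn],
    which is why [f] and [r] are arbitrary. *)
Lemma adjacent_trans (T : Type) (r : rel T) (f : 'I_n -> T) (k l : 'I_n) :
  transitive r -> (k < l)%N ->
  (forall j : 'I_n.-1, (k <= j)%N -> (j < l)%N -> r (f (lo j)) (f (hi j))) -> r (f k) (f l).
Proof.
move=> tr kl H; have [d dE] : exists d, l = (k + d).+1 :> nat by exists (l - k.+1)%N; lia.
elim: d l dE {kl} H => [|d IHd] l lE H.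
  have kn : (k < n.-1)%N by have := ltn_ord l; lia.
  have -> : k = lo (Ordinal kn) by apply: val_inj.
  have -> : l = hi (Ordinal kn) by apply: val_inj; rewrite /= lE addn0.
  by apply: H => //=; lia.
have mn : (k + d.+1 < n.-1)%N by have := ltn_ord l; lia.
have -> : l = hi (Ordinal mn) by apply: val_inj; rewrite /= lE addnS.
apply: (tr (f (lo (Ordinal mn)))); last by apply: H => /=; lia.
apply: IHd => [|j kj jl]; first by rewrite /= addnS.
by apply: H => //; move: jl => /=; lia.
Qed.

Lemma ldescentN i x : ~~ ldescent i x = (x (lo i) < x (hi i))%N.
Proof.
rewrite /ldescent -leqNgt leq_eqVlt (inj_eq val_inj) (inj_eq perm_inj).
by rewrite (negPf (lo_neq_hi i)).
Qed.

Lemma ldescent_mul i x : ldescent i (s i * x)%g = ~~ ldescent i x.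
Proof.
rewrite /ldescent !permM simple_refl_lo simple_refl_hi -leqNgt ltn_neqAle.
by rewrite (inj_eq val_inj) (inj_eq perm_inj) lo_neq_hi.
Qed.

Lemma ldescent1 i : ldescent i 1%g = false.
Proof. by rewrite /ldescent !perm1 /= ltnNge leqnSn. Qed.

Definition inversions x : {set 'I_n * 'I_n} :=
  [set p : 'I_n * 'I_n | (p.1 < p.2)%N && (x p.2 < x p.1)%N].

(** Applying [s i] to both entries of a pair carries the inversions of [x] onto those of [s i * x]
    other than [(lo i, hi i)], which is the new one. *)
Lemma card_inversions_up i x : ~~ ldescent i x ->
  #|inversions (s i * x)%g| = #|inversions x|.+1.
Proof.
move=> up.
pose g (p : 'I_n * 'I_n) := (s i p.1, s i p.2).
have gK : involutive g by case=> a b; rewrite /g /= !simple_reflK.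
have -> : inversions (s i * x)%g = (lo i, hi i) |: g @: inversions x.
  apply/setP=> -[a b]; rewrite !inE /= !permM -{2}[(a, b)]gK mem_imset; last exact: inv_inj gK.
  rewrite inE /= xpair_eqE -!val_eqE /=.
  have [ai|ai] := eqVneq (a : nat) i.
  - have -> : a = lo i by apply: val_inj.
    rewrite /= simple_refl_lo.
    have [bi|bi] := eqVneq (b : nat) i.+1.
      have -> : b = hi i by apply: val_inj.
      rewrite simple_refl_hi /=; move: up; rewrite /ldescent -leqNgt => up.
      rewrite ltnSn /= ltn_neqAle up andbT.
      by rewrite (inj_eq val_inj) (inj_eq perm_inj) lo_neq_hi.
    have [bi'|bi'] := eqVneq (b : nat) i.
      have -> : b = lo i by apply: val_inj.
      by rewrite /= simple_refl_lo !ltnn.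
    by rewrite simple_refl_id //=; congr (_ && _); lia.
  - rewrite /=.
    have [aSi|aSi] := eqVneq (a : nat) i.+1.
      have -> : a = hi i by apply: val_inj.
      rewrite simple_refl_hi.
      have [bi'|bi'] := eqVneq (b : nat) i.
        have -> : b = lo i by apply: val_inj.
        rewrite simple_refl_lo /=; move: up; rewrite /ldescent => /negPf->.
        by rewrite !andbF.
      have [bi|bi] := eqVneq (b : nat) i.+1.
        have -> : b = hi i by apply: val_inj.
        by rewrite simple_refl_hi !ltnn.
      by rewrite simple_refl_id //=; congr (_ && _); lia.
    rewrite (simple_refl_id ai aSi).
    have [bi'|bi'] := eqVneq (b : nat) i.
      have -> : b = lo i by apply: val_inj.
      by rewrite simple_refl_lo /=; congr (_ && _); lia.
    have [bi|bi] := eqVneq (b : nat) i.+1.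
      have -> : b = hi i by apply: val_inj.
      by rewrite simple_refl_hi /=; congr (_ && _); lia.
    by rewrite !simple_refl_id.
rewrite cardsU1 (card_imset _ (inv_inj gK)) -{1}[(lo i, hi i)]gK mem_imset; last exact: inv_inj gK.
by rewrite inE /g /= simple_refl_lo simple_refl_hi /= ltnNge leqnSn.
Qed.

Lemma card_inversions_down i x : ldescent i x ->
  #|inversions x| = #|inversions (s i * x)%g|.+1.
Proof. by move=> d; rewrite -(@card_inversions_up i) ?mulsKg // ldescent_mul negbK. Qed.

Lemma inversions1 : inversions 1%g = set0.
Proof. by apply/setP=> p; rewrite !inE !perm1; case: ltngtP. Qed.

(* The value [x i] counts the [k < i] not inverted with [i] and the [k > i] inverted with [i]. *)
Lemma inversions_inj : injective inversions.
Proof.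
move=> x y /setP xy; apply/permP=> i; apply: val_inj.
have E (z : 'S_n) : z i = #|[set k : 'I_n | (z k < z i)%N]| :> nat.
  have -> : [set k : 'I_n | (z k < z i)%N] = z @^-1: [set m : 'I_n | (m < z i)%N].
    by apply/setP=> k; rewrite !inE.
  rewrite card_preimset; last exact: perm_inj.
  rewrite cardsE -sum1_card (eq_bigl (fun m : 'I_n => (m < z i)%N)) //.
  by rewrite (big_ord_narrow (ltnW (ltn_ord (z i)))) sum1_card card_ord.
rewrite -[LHS]/(nat_of_ord _) -[RHS]/(nat_of_ord _) (E x) (E y); apply: eq_card => k; rewrite !inE.
have := xy (k, i); have := xy (i, k); rewrite !inE /=.
case: (ltngtP k i) => [ki|ki|/val_inj->]; rewrite ?ltnn //=.
move=> _ H.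
have F (z : 'S_n) : (z k < z i)%N = ~~ (z i < z k)%N.
  rewrite -leqNgt [RHS]leq_eqVlt (inj_eq val_inj) (inj_eq perm_inj).
  by rewrite -val_eqE ltn_eqF.
by rewrite !F H.
Qed.

(** A permutation without descent is increasing, so it has the inversion set of 1. *)
Lemma ldescent_exists x : x != 1%g -> exists i, ldescent i x.
Proof.
move=> x1; apply/existsP; apply: contraNT x1; rewrite negb_exists => /forallP up.
apply/eqP/inversions_inj; rewrite inversions1.
apply/setP=> -[a b]; rewrite !inE /=; apply/negP=> /andP[ab].
have := @adjacent_trans nat ltn (fun k => x k : nat) a b ltn_trans ab.
rewrite /= => H; rewrite ltnNge ltnW // H // => j _ _.
by rewrite -ldescentN up.
Qed.

Lemma word_prod_cons i a : word_prod (i :: a) = (s i * word_prod a)%g.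
Proof. by rewrite /word_prod big_cons. Qed.

Lemma word_prod_nil : word_prod [::] = 1%g :> 'S_n.
Proof. by rewrite /word_prod big_nil. Qed.

Lemma word_prod_cat a b : word_prod (a ++ b) = (word_prod a * word_prod b)%g.
Proof. by rewrite /word_prod big_cat. Qed.

Lemma word_prod_rev a : word_prod (rev a) = (word_prod a)^-1%g.
Proof.
elim: a => [|i a IHa]; first by rewrite word_prod_nil invg1.
by rewrite rev_cons -cats1 word_prod_cat IHa !word_prod_cons word_prod_nil mulg1 invMg simple_reflV.
Qed.

(** Each letter changes the number of inversions by one, and stripping descents reaches 1 in exactly
    that many steps. *)
Lemma perm_lengthE x : perm_length x = #|inversions x|.
Proof.
have low a : (#|inversions (word_prod a)| <= size a)%N.
  elim: a => [|i a IHa]; first by rewrite word_prod_nil inversions1 cards0.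
  rewrite word_prod_cons /=.
  case: (boolP (ldescent i (word_prod a))) => [d|u]; last by rewrite card_inversions_up.
  by apply/ltnW; rewrite ltnS; apply: leq_trans IHa; rewrite (card_inversions_down d).
have up m y : #|inversions y| = m -> exists a : m.-tuple 'I_n.-1, word_prod a == y.
  elim: m y => [|m IHm] y ym.
    exists [tuple]; rewrite word_prod_nil; apply/eqP/inversions_inj.
    by rewrite inversions1; apply/esym/cards0_eq.
  have [i di] : exists i, ldescent i y.
    by apply: ldescent_exists; apply: contra_eqN ym => /eqP->; rewrite inversions1 cards0.
  have [|a /eqP aE] := IHm (s i * y)%g.
    by apply: succn_inj; rewrite -card_inversions_down.
  by exists [tuple of i :: a]; rewrite word_prod_cons aE mulsKg.
rewrite /perm_length; case: ex_minnP => m /existsP[a /eqP aE] mmin.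
apply/eqP; rewrite eqn_leq; apply/andP; split.
  by apply: mmin; apply/existsP; apply: up.
by rewrite -aE -[X in (_ <= X)%N](size_tuple a).
Qed.

Lemma perm_length_up i x : ~~ ldescent i x -> perm_length (s i * x)%g = (perm_length x).+1.
Proof. by rewrite !perm_lengthE; apply: card_inversions_up. Qed.

Lemma perm_length_down i x : ldescent i x -> perm_length x = (perm_length (s i * x)%g).+1.
Proof. by rewrite !perm_lengthE; apply: card_inversions_down. Qed.

Lemma ldescentE i x : ldescent i x = (perm_length (s i * x)%g < perm_length x)%N.
Proof.
case: (boolP (ldescent i x)) => [/perm_length_down->|/perm_length_up->]; first by rewrite ltnSn.
by rewrite ltnNge leqnSn.
Qed.

Lemma perm_length1 : perm_length (1%g : 'S_n) = 0%N.
Proof. by rewrite perm_lengthE inversions1 cards0. Qed.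

Lemma perm_length_word a : (perm_length (word_prod a) <= size a)%N.
Proof.
rewrite /perm_length; case: ex_minnP => m _; apply.
by apply/existsP; exists (in_tuple a).
Qed.

Lemma reduced_wordP x : word_prod (reduced_word x) = x /\ size (reduced_word x) = perm_length x.
Proof.
by rewrite /reduced_word size_tuple; split=> //; apply/eqP/(xchooseP (reduced_word_exists x)).
Qed.

Lemma perm_lengthV x : perm_length x^-1%g = perm_length x.
Proof.
suff H (y : 'S_n) : (perm_length y^-1%g <= perm_length y)%N.
  by apply/eqP; rewrite eqn_leq H -{1}[x]invgK H.
have [yE ys] := reduced_wordP y.
by rewrite -ys -{1}yE -word_prod_rev -(size_rev (reduced_word y)) perm_length_word.
Qed.

Lemma ldescentV i x : ldescent i x^-1%g = (perm_length (x * s i)%g < perm_length x)%N.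
Proof. by rewrite ldescentE perm_lengthV -(perm_lengthV (x * s i)%g) invMg simple_reflV. Qed.

(** Only [s i] moves a point across the boundary between [i] and [i.+1]. All the arguments on words
    with distinct letters use this invariant. *)
Lemma word_prod_stable i a (u : 'I_n) : i \notin a -> (word_prod a u <= i)%N = (u <= i)%N.
Proof.
elim: a u => [|j a IHa] u; first by rewrite word_prod_nil perm1.
rewrite inE negb_or => /andP[ij ia]; rewrite word_prod_cons permM {}IHa //.
have {}ij : i != j :> nat by [].
have [uj|uj] := eqVneq (u : nat) j.
  have -> : u = lo j by apply: val_inj.
  by rewrite simple_refl_lo /=; lia.
have [uSj|uSj] := eqVneq (u : nat) j.+1.
  have -> : u = hi j by apply: val_inj.
  by rewrite simple_refl_hi /=; lia.
by rewrite simple_refl_id.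
Qed.

Lemma ldescent_fresh i a : i \notin a -> ~~ ldescent i (word_prod a).
Proof.
move=> ia; have := word_prod_stable (lo i) ia; have := word_prod_stable (hi i) ia.
by rewrite /ldescent /=; lia.
Qed.

Lemma perm_length_uniq a : uniq a -> perm_length (word_prod a) = size a.
Proof.
elim: a => [|i a IHa] /=; first by rewrite word_prod_nil perm_length1.
by case/andP=> ia /IHa <-; rewrite word_prod_cons perm_length_up ?ldescent_fresh.
Qed.

End Perm.

(** * The standard basis and the symmetrizing trace *)

Section Hecke.
Variables (R : comNzRingType) (Q : R) (n : nat).
Local Notation H := (hecke Q n).
Local Notation s := (@simple_refl n).
Local Notation T := (hgen Q).
Implicit Types (i j : 'I_n.-1) (x y w : 'S_n) (a b : seq 'I_n.-1) (z h : H).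

Definition hword a : H := \prod_(i <- a) T i.

Lemma hword_nil : hword [::] = 1. Proof. by rewrite /hword big_nil. Qed.
Lemma hword_cons i a : hword (i :: a) = T i * hword a.
Proof. by rewrite /hword big_cons. Qed.
Lemma hword_cat a b : hword (a ++ b) = hword a * hword b.
Proof. by rewrite /hword big_cat. Qed.

Lemma hgen_braid i j : j = i.+1 :> nat -> T i * T j * T i = T j * T i * T j.
Proof. by have [+ _ _] := hgen_relations Q n; apply. Qed.
Lemma hgen_comm i j : (i.+1 < j)%N -> T i * T j = T j * T i.
Proof. by have [_ + _] := hgen_relations Q n; apply. Qed.
Lemma hgen_quad i : T i * T i = Q *: T i + 1.
Proof. by have [_ _ +] := hgen_relations Q n; apply. Qed.

Definition reduced a := perm_length (word_prod a) == size a.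

Lemma reduced_cons i a : reduced (i :: a) -> reduced a /\ ldescent i (word_prod (i :: a)).
Proof.
rewrite /reduced word_prod_cons ldescent_mul /=.
case: (boolP (ldescent i (word_prod a))) => [/perm_length_down E /eqP F|/perm_length_up ->].
by have := perm_length_word a; rewrite E F; lia.
by case/eqP=> ->.
Qed.

Lemma reduced_reduced_word x : reduced (reduced_word x).
Proof. by have [E F] := reduced_wordP x; rewrite /reduced E F. Qed.

(** If [x] descends at both [i] and [j], it has reduced words beginning with the two sides of the
    commutation or braid relation between them, followed by the same word. *)
Lemma two_descents i j x : (i < j)%N -> ldescent i x -> ldescent j x ->
  exists u v, [/\ word_prod (i :: u) = x, word_prod (j :: v) = x,
    reduced (i :: u), reduced (j :: v) & hword (i :: u) = hword (j :: v)].
Proof.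
move=> ij di dj.
have [ij1|ij1] := ltnP i.+1 j.
  have djs : ldescent j (s i * x)%g.
    move: dj; rewrite /ldescent !permM.
    by rewrite (@simple_refl_id _ i (hi j)) ?(@simple_refl_id _ i (lo j)) //=; lia.
  pose c := reduced_word (s j * (s i * x))%g.
  have [cE cs] := reduced_wordP (s j * (s i * x))%g.
  have sc : perm_length x = (size c).+2.
    by rewrite /c cs (perm_length_down di) (perm_length_down djs).
  have E1 : word_prod (i :: j :: c) = x by rewrite !word_prod_cons cE !mulsKg.
  have E2 : word_prod (j :: i :: c) = x.
    by rewrite -E1 !word_prod_cons !mulgA (simple_refl_comm ij1).
  exists (j :: c), (i :: c); rewrite /reduced E1 E2 sc /= eqxx; split=> //.
  by rewrite !hword_cons !mulrA hgen_comm.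
have ijE : j = i.+1 :> nat by lia.
have hl : hi i = lo j by apply: val_inj; rewrite /= ijE.
have djs : ldescent j (s i * x)%g.
  move: di dj; rewrite /ldescent !permM -hl simple_refl_hi (@simple_refl_id _ i (hi j)) /=; lia.
have dijs : ldescent i (s j * (s i * x))%g.
  move: di dj; rewrite /ldescent !permM hl simple_refl_lo (@simple_refl_id _ j (lo i)) /=; try lia.
  by rewrite simple_refl_lo hl (@simple_refl_id _ i (hi j)) //=; lia.
pose w := (s i * (s j * (s i * x)))%g; pose c := reduced_word w.
have [cE cs] := reduced_wordP w.
have sc : perm_length x = (size c).+3.
  by rewrite /c cs (perm_length_down di) (perm_length_down djs) (perm_length_down dijs).
have E1 : word_prod (i :: j :: i :: c) = x by rewrite !word_prod_cons cE !mulsKg.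
have E2 : word_prod (j :: i :: j :: c) = x.
  by rewrite -E1 !word_prod_cons !mulgA (simple_refl_braid ijE).
exists (j :: i :: c), (i :: j :: c); rewrite /reduced E1 E2 sc /= eqxx; split=> //.
by rewrite !hword_cons !mulrA hgen_braid.
Qed.

Lemma matsumoto a b :
  reduced a -> reduced b -> word_prod a = word_prod b -> hword a = hword b.
Proof.
have [m] := ubnP (size a); elim: m a b => // m IHm a b am ra rb ab.
have sab : size a = size b by move: ra rb; rewrite /reduced ab => /eqP <- /eqP.
case: a b sab am ra rb ab => [|i a] [|j b] //= [sab] am ria rjb ab.
have [ra dia] := reduced_cons ria; have [rb djb] := reduced_cons rjb.
have IH u v : (size u < m)%N -> reduced u -> reduced v -> word_prod u = word_prod v ->
    hword u = hword v by move=> *; apply: IHm.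
have key k (u v : seq 'I_n.-1) : (size u < m)%N -> reduced u -> reduced (k :: v) ->
    word_prod (k :: u) = word_prod (k :: v) -> hword (k :: u) = hword (k :: v).
  move=> um ru /reduced_cons[rv _] E; rewrite !hword_cons; congr (_ * _).
  by apply: IH => //; move: E; rewrite !word_prod_cons => /mulgI.
have bm : (size b < m)%N by rewrite -sab; lia.
have [ij|ji|/val_inj ij] := ltngtP i j; last first.
- by subst j; apply: key.
- have := two_descents ji djb; rewrite -ab => /(_ dia) [u [v [E1 E2 r1 r2 E]]].
  by rewrite (key i a v) ?(key j b u) ?E // -?ab ?E1 ?E2.
have := two_descents ij dia; rewrite ab => /(_ djb) [u [v [E1 E2 r1 r2 E]]].
by rewrite (key i a u) ?(key j b v) ?E // -?ab ?E1 ?E2 ?ab.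
Qed.

Lemma hT_reduced a : reduced a -> hT Q (word_prod a) = hword a.
Proof.
move=> ra; apply: matsumoto => //; first exact: reduced_reduced_word.
by have [] := reduced_wordP (word_prod a).
Qed.

Lemma hT1 : hT Q (1%g : 'S_n) = 1.
Proof. by rewrite -word_prod_nil hT_reduced ?hword_nil // /reduced word_prod_nil perm_length1. Qed.

Lemma hT_uniq a : uniq a -> hT Q (word_prod a) = hword a.
Proof. by move=> ua; rewrite hT_reduced // /reduced perm_length_uniq. Qed.

Lemma hT_lmul_up i x : ~~ ldescent i x -> hT Q (s i * x)%g = T i * hT Q x.
Proof.
move=> u; have [E F] := reduced_wordP x.
rewrite -{1}E -word_prod_cons hT_reduced ?hword_cons //.
by rewrite /reduced word_prod_cons E perm_length_up //= F.
Qed.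

Lemma hT_rmul_up i x : ~~ ldescent i x^-1%g -> hT Q (x * s i)%g = hT Q x * T i.
Proof.
move=> u; have [E F] := reduced_wordP x.
have Ec : word_prod (reduced_word x ++ [:: i]) = (x * s i)%g.
  by rewrite word_prod_cat E word_prod_cons word_prod_nil mulg1.
rewrite -Ec hT_reduced ?hword_cat ?hword_cons ?hword_nil ?mulr1 //.
rewrite /reduced Ec size_cat F addn1.
by rewrite -perm_lengthV invMg simple_reflV perm_length_up // perm_lengthV.
Qed.

Lemma hT_lmul i x : T i * hT Q x = hT Q (s i * x)%g + (if ldescent i x then Q *: hT Q x else 0).
Proof.
case: (boolP (ldescent i x)) => [d|/hT_lmul_up->]; last by rewrite addr0.
have u : ~~ ldescent i (s i * x)%g by rewrite ldescent_mul d.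
have E := hT_lmul_up u; rewrite mulsKg in E.
by rewrite E mulrA hgen_quad mulrDl mul1r -scalerAl addrC.
Qed.

Lemma hT_rmul i x :
  hT Q x * T i = hT Q (x * s i)%g + (if ldescent i x^-1%g then Q *: hT Q x else 0).
Proof.
case: (boolP (ldescent i x^-1%g)) => [d|/hT_rmul_up->]; last by rewrite addr0.
have u : ~~ ldescent i (x * s i)^-1%g by rewrite invMg simple_reflV ldescent_mul d.
have E := hT_rmul_up u; rewrite mulgKs in E.
by rewrite E -mulrA hgen_quad mulrDr mulr1 -scalerAr addrC.
Qed.

(** * Linear independence of the T_w: the left regular representation *)

Local Notation V := {ffun 'S_n -> R}.
Implicit Types v : V.

Definition hgen_act i v : V :=
  [ffun x => v (s i * x)%g + (if ldescent i x then Q * v x else 0)].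

Lemma hgen_act_braid i j v : j = i.+1 :> nat ->
  hgen_act i (hgen_act j (hgen_act i v)) = hgen_act j (hgen_act i (hgen_act j v)).
Proof.
move=> ij; have hl : hi i = lo j by apply: val_inj; rewrite /= ij.
apply/ffunP=> x; rewrite !ffunE.
have -> : (s j * (s i * (s j * x)) = s i * (s j * (s i * x)))%g.
  by rewrite !mulgA -(simple_refl_braid ij).
have il : s i (hi j) = hi j by rewrite simple_refl_id //=; lia.
have jl : s j (lo i) = lo i by rewrite simple_refl_id //=; lia.
have sil : s i (lo j) = lo i by rewrite -hl simple_refl_hi.
have sii : s i (lo i) = lo j by rewrite simple_refl_lo.
rewrite /ldescent !permM !mulsKg.
do 8? rewrite ?hl ?il ?jl ?sil ?sii ?(simple_refl_lo j) ?(simple_refl_hi j).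
have ac : (x (lo i) : nat) != x (hi j).
  by rewrite (inj_eq val_inj) (inj_eq perm_inj) -val_eqE /= ij; lia.
have ab : (x (lo i) : nat) != x (lo j).
  by rewrite (inj_eq val_inj) (inj_eq perm_inj) -val_eqE /= ij; lia.
have bc : (x (lo j) : nat) != x (hi j).
  by rewrite (inj_eq val_inj) (inj_eq perm_inj) lo_neq_hi.
(* Only the relative order of the values of [x] at the three positions matters; each possible order
   leaves a ring identity. *)
move: ab bc ac; move: (x (lo i) : nat) (x (lo j) : nat) (x (hi j) : nat) => a b c.
case: (ltngtP a b) => // ? _; case: (ltngtP b c) => // ? _; case: (ltngtP a c) => // ? _;
  try lia; ring.
Qed.

Lemma hgen_act_comm i j v : (i.+1 < j)%N ->
  hgen_act i (hgen_act j v) = hgen_act j (hgen_act i v).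
Proof.
move=> ij; apply/ffunP=> x; rewrite !ffunE.
have -> : (s j * (s i * x) = s i * (s j * x))%g by rewrite !mulgA (simple_refl_comm ij).
have id : ldescent j (s i * x)%g = ldescent j x.
  by rewrite /ldescent !permM !(@simple_refl_id _ i) //=; lia.
have jd : ldescent i (s j * x)%g = ldescent i x.
  by rewrite /ldescent !permM !(@simple_refl_id _ j) //=; lia.
rewrite id jd; case: ifP => _; case: ifP => _; ring.
Qed.

Lemma hgen_act_quad i v :
  hgen_act i (hgen_act i v) = [ffun x => Q * hgen_act i v x + v x].
Proof.
apply/ffunP=> x; rewrite !ffunE mulsKg ldescent_mul.
by case: (ldescent i x) => /=; ring.
Qed.

(** Being defined on terms, the action only has to respect [heq] to descend to the quotient. *)
Fixpoint hterm_act (t : hterm R n) v : V :=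
  match t with
  | HGen i => hgen_act i v
  | HScal c => [ffun x => c * v x]
  | HAdd t1 t2 => [ffun x => hterm_act t1 v x + hterm_act t2 v x]
  | HMul t1 t2 => hterm_act t1 (hterm_act t2 v)
  end.

(** Right distributivity and the centrality of scalars are clauses of [heq]; they hold for the
    action because every term acts linearly. *)
Lemma hterm_act_linear t (c : R) (u v : V) :
  hterm_act t [ffun x => c * u x + v x] = [ffun x => c * hterm_act t u x + hterm_act t v x].
Proof.
elim: t u v => [i|d|t1 IH1 t2 IH2|t1 IH1 t2 IH2] u v /=.
- by apply/ffunP=> x; rewrite !ffunE; case: ifP => _; ring.
- by apply/ffunP=> x; rewrite !ffunE; ring.
- by apply/ffunP=> x; rewrite IH1 IH2 !ffunE; ring.
- by rewrite IH2 IH1.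
Qed.

Lemma hterm_actD t (u v : V) :
  hterm_act t [ffun x => u x + v x] = [ffun x => hterm_act t u x + hterm_act t v x].
Proof.
have -> : [ffun x => u x + v x] = [ffun x => 1 * u x + v x].
  by apply/ffunP=> x; rewrite !ffunE mul1r.
by rewrite hterm_act_linear; apply/ffunP=> x; rewrite !ffunE mul1r.
Qed.

Lemma hterm_actZ t c v : hterm_act t [ffun x => c * v x] = [ffun x => c * hterm_act t v x].
Proof.
have z0 : hterm_act t [ffun=> 0] = [ffun=> 0].
  have := hterm_act_linear t (-1) v v.
  by rewrite (_ : [ffun _ => _] = [ffun=> 0]) => [->|]; apply/ffunP=> x; rewrite !ffunE; ring.
have -> : [ffun x => c * v x] = [ffun x => c * v x + [ffun=> 0] x].
  by apply/ffunP=> x; rewrite !ffunE addr0.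
by rewrite hterm_act_linear z0; apply/ffunP=> x; rewrite !ffunE addr0.
Qed.

Lemma heq_hterm_act t1 t2 v : heq Q t1 t2 -> hterm_act t1 v = hterm_act t2 v.
Proof.
move=> E; elim: E v => {t1 t2} //=.
- by move=> t2 t1 t3 _ IH1 _ IH2 v; rewrite IH1.
- by move=> t1 t1' t2 t2' _ IH1 _ IH2 v; rewrite IH1 IH2.
- by move=> t1 t1' t2 t2' _ IH1 _ IH2 v; rewrite IH1 IH2.
- by move=> t1 t2 t3 v; apply/ffunP=> x; rewrite !ffunE addrA.
- by move=> t1 t2 v; apply/ffunP=> x; rewrite !ffunE addrC.
- by move=> t v; apply/ffunP=> x; rewrite !ffunE; ring.
- by move=> t v; apply/ffunP=> x; rewrite !ffunE; ring.
- by move=> t v; apply/ffunP=> x; rewrite !ffunE; ring.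
- by move=> t1 t2 t3 v; rewrite hterm_actD.
- by move=> c t v; rewrite hterm_actZ.
- by move=> c d v; apply/ffunP=> x; rewrite !ffunE; ring.
- by move=> c d v; apply/ffunP=> x; rewrite !ffunE; ring.
- by move=> i j ij v; rewrite (hgen_act_braid _ ij).
- by move=> i j ij v; rewrite (hgen_act_comm _ ij).
- by move=> i v; rewrite hgen_act_quad; apply/ffunP=> x; rewrite !ffunE; ring.
Qed.

Definition hact z v : V := hterm_act (repr z) v.

Lemma hact_pi t v : hact (\pi_H t)%qT v = hterm_act t v.
Proof. exact/heq_hterm_act/hreprP. Qed.

Lemma hact_gen i v : hact (T i) v = hgen_act i v.
Proof. exact: hact_pi. Qed.

Lemma hactD z1 z2 v x : hact (z1 + z2) v x = hact z1 v x + hact z2 v x.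
Proof. by rewrite [hact (z1 + z2) v]hact_pi ffunE. Qed.

Lemma hactM z1 z2 v : hact (z1 * z2) v = hact z1 (hact z2 v).
Proof. exact: hact_pi. Qed.

Lemma hactZ c z v x : hact (c *: z) v x = c * hact z v x.
Proof. by rewrite [hact (c *: z) v]hactM [hact (hscal Q n c) _]hact_pi ffunE. Qed.

Lemma hact1 v : hact 1 v = v.
Proof. by rewrite [hact 1 v]hact_pi; apply/ffunP=> x; rewrite ffunE mul1r. Qed.

(** The indicator function of 1 stands for T_1, so the action of [z] on it lists the coefficients of
    [z]. *)
Definition hcoef z x : R := hact z [ffun y => (y == 1%g)%:R] x.

Lemma hcoefD z1 z2 x : hcoef (z1 + z2) x = hcoef z1 x + hcoef z2 x.
Proof. exact: hactD. Qed.

Lemma hcoefZ c z x : hcoef (c *: z) x = c * hcoef z x.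
Proof. exact: hactZ. Qed.

Lemma hcoef0 x : hcoef 0 x = 0.
Proof. by have := hcoefZ 0 0 x; rewrite scale0r mul0r. Qed.

Lemma hcoefB z1 z2 x : hcoef (z1 - z2) x = hcoef z1 x - hcoef z2 x.
Proof. by rewrite -scaleN1r hcoefD hcoefZ mulN1r. Qed.

Lemma hcoef_sum (I : Type) (r : seq I) (P : pred I) (F : I -> H) x :
  hcoef (\sum_(k <- r | P k) F k) x = \sum_(k <- r | P k) hcoef (F k) x.
Proof.
elim: r => [|k r IH]; first by rewrite !big_nil hcoef0.
by rewrite !big_cons; case: ifP => // _; rewrite hcoefD IH.
Qed.

Lemma hcoef_lmul i z x :
  hcoef (T i * z) x = hcoef z (s i * x)%g + (if ldescent i x then Q * hcoef z x else 0).
Proof. by rewrite /hcoef hactM hact_gen ffunE. Qed.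

Lemma hcoef_hT w x : hcoef (hT Q w) x = (x == w)%:R.
Proof.
have [m] := ubnP (perm_length w); elim: m w x => // m IHm w x wm.
have [->|w1] := eqVneq w 1%g; first by rewrite hT1 /hcoef hact1 ffunE.
have [i di] := ldescent_exists w1.
have u : ~~ ldescent i (s i * w)%g by rewrite ldescent_mul di.
have := hT_lmul_up u; rewrite mulsKg => ->.
have lm : (perm_length (s i * w)%g < m)%N by rewrite -ltnS -(perm_length_down di).
rewrite hcoef_lmul !(IHm _ _ lm) (can2_eq (mulsKg i) (mulsKg i)) mulsKg.
case: ifP => [dx|]; last by rewrite addr0.
have [xw|_] := eqVneq x (s i * w)%g; last by rewrite mulr0 addr0.
by move: dx; rewrite xw (negPf u).
Qed.

Lemma hpiD t1 t2 : (\pi_H (HAdd t1 t2))%qT = ((\pi_H t1)%qT : H) + (\pi_H t2)%qT.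
Proof. exact/esym/haddE. Qed.

Lemma hpiM t1 t2 : (\pi_H (HMul t1 t2))%qT = ((\pi_H t1)%qT : H) * (\pi_H t2)%qT.
Proof. exact/esym/hmulE. Qed.

(** The span of the [hT Q w] is stable under left multiplication by generators ([hT_lmul]), hence
    under products, so it contains the class of every term. *)
Lemma hT_span_ind (P : H -> Prop) :
  P 0 -> (forall z1 z2, P z1 -> P z2 -> P (z1 + z2)) -> (forall c w, P (c *: hT Q w)) ->
  forall z, P z.
Proof.
move=> P0 PD PT z.
suff [c ->] : exists c : 'S_n -> R, z = \sum_w c w *: hT Q w by apply: big_ind.
rewrite -[z]reprK; elim: (repr z) => {z P P0 PD PT} [i|d|t1 IH1 t2 IH2|t1 IH1 t2 IH2].
- exists (fun w => (w == s i)%:R); rewrite (bigD1 (s i)) //= eqxx scale1r big1 ?addr0.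
    by rewrite -[s i]mulg1 hT_lmul_up ?ldescent1 // hT1 mulr1.
  by move=> w /negPf->; rewrite scale0r.
- exists (fun w => (w == 1%g)%:R * d); rewrite (bigD1 1%g) //= eqxx mul1r big1 ?addr0.
    by rewrite hT1; apply/esym/mulr1.
  by move=> w /negPf->; rewrite mul0r scale0r.
- case: IH1 => c1 E1; case: IH2 => c2 E2; exists (fun w => c1 w + c2 w).
  rewrite hpiD E1 E2 -big_split /=.
  by apply: eq_bigr => w _; rewrite scalerDl.
case: IH1 => c1 E1; case: IH2 => c2 E2.
rewrite hpiM E1 E2 {t1 t2 E1 E2}.
pose S z := exists c : 'S_n -> R, z = \sum_w c w *: hT Q w.
have SD z1 z2 : S z1 -> S z2 -> S (z1 + z2).
  move=> [d1 ->] [d2 ->]; exists (fun w => d1 w + d2 w); rewrite -big_split /=.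
  by apply: eq_bigr => w _; rewrite scalerDl.
have SZ d z : S z -> S (d *: z).
  move=> [d1 ->]; exists (fun w => d * d1 w); rewrite scaler_sumr.
  by apply: eq_bigr => w _; rewrite scalerA.
have S0 : S 0 by exists (fun=> 0); rewrite big1 // => w _; rewrite scale0r.
have ST w : S (hT Q w).
  exists (fun x => (x == w)%:R); rewrite (bigD1 w) //= eqxx scale1r big1 ?addr0 //.
  by move=> x /negPf->; rewrite scale0r.
have SL i z : S z -> S (T i * z).
  move=> [d ->]; rewrite mulr_sumr; apply: (big_ind S) => // w _.
  rewrite -scalerAr; apply: (SZ (d w)); rewrite hT_lmul; apply: SD => //.
  by case: ifP => _; [apply: (SZ Q)|].
rewrite mulr_suml; apply: (big_ind S) => // w _.
rewrite -scalerAl; apply: (SZ (c1 w)).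
have S2 : S (\sum_x c2 x *: hT Q x) by exists c2.
move: S2; move: (\sum_x _) => z2 S2; rewrite /hT.
elim: (reduced_word w) => [|i a IHa].
  by rewrite big_nil mul1r.
by rewrite big_cons -mulrA; apply: SL.
Qed.

Lemma hcoefE z : z = \sum_w hcoef z w *: hT Q w.
Proof.
elim/hT_span_ind: z => [|z1 z2 {1}-> {1}->|c w].
- by rewrite big1 // => w _; rewrite hcoef0 scale0r.
- by rewrite -big_split /=; apply: eq_bigr => w _; rewrite hcoefD scalerDl.
rewrite (bigD1 w) //= hcoefZ hcoef_hT eqxx mulr1 big1 ?addr0 //.
by move=> x /negPf xw; rewrite hcoefZ hcoef_hT xw mulr0 scale0r.
Qed.

Lemma hcoef_inj z1 z2 : hcoef z1 =1 hcoef z2 -> z1 = z2.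
Proof. by move=> E; rewrite [z1]hcoefE [z2]hcoefE; apply: eq_bigr => w _; rewrite E. Qed.

Definition htau z := hcoef z 1%g.

Lemma htau0 : htau 0 = 0. Proof. exact: hcoef0. Qed.
Lemma htauD z1 z2 : htau (z1 + z2) = htau z1 + htau z2. Proof. exact: hcoefD. Qed.
Lemma htauZ c z : htau (c *: z) = c * htau z. Proof. exact: hcoefZ. Qed.

(** On [hT Q w] both sides test whether [w] is [s i]; the terms in [Q] vanish because 1 has no
    descent. *)
Lemma htau_gen i z : htau (T i * z) = htau (z * T i).
Proof.
elim/hT_span_ind: z => [|z1 z2 E1 E2|c w].
- by rewrite mulr0 mul0r.
- by rewrite mulrDr mulrDl !htauD E1 E2.
rewrite -scalerAr -scalerAl !htauZ; congr (_ * _).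
rewrite /htau hcoef_lmul ldescent1 addr0 mulg1 hT_rmul hcoefD !hcoef_hT.
rewrite -[in RHS](inj_eq (mulIg (s i))) mul1g mulgKs.
case: ifP => [d|_]; last by rewrite hcoef0 addr0.
rewrite hcoefZ hcoef_hT; have [w1|_] := eqVneq 1%g w; last by rewrite mulr0 addr0.
by move: d; rewrite -w1 invg1 ldescent1.
Qed.

Lemma htauC z1 z2 : htau (z1 * z2) = htau (z2 * z1).
Proof.
elim/hT_span_ind: z1 => [|z z' E E'|c w]; first by rewrite mulr0 mul0r.
  by rewrite mulrDr mulrDl !htauD E E'.
rewrite -scalerAr -scalerAl !htauZ; congr (_ * _); rewrite /hT.
elim: (reduced_word w) z2 => [|i a IHa] z2; first by rewrite big_nil mulr1 mul1r.
by rewrite big_cons -mulrA htau_gen -mulrA IHa mulrA.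
Qed.

Lemma htau_hT2 w x : htau (hT Q w * hT Q x) = (w * x == 1)%g%:R.
Proof.
have [m] := ubnP (perm_length w); elim: m w x => // m IHm w x wm.
have [->|w1] := eqVneq w 1%g.
  by rewrite hT1 mul1r mul1g /htau hcoef_hT eq_sym.
have [|i di] := @ldescent_exists _ w^-1%g.
  by rewrite invg_eq1.
have u : ~~ ldescent i (w * s i)^-1%g by rewrite invMg simple_reflV ldescent_mul di.
have := hT_rmul_up u; rewrite mulgKs => ->; rewrite -mulrA hT_lmul mulrDr htauD.
have lm : (perm_length (w * s i)%g < m)%N.
  by rewrite -ltnS -perm_lengthV invMg simple_reflV -(perm_length_down di) perm_lengthV.
rewrite IHm // mulgA mulgKs.
case: ifP => [dx|_]; last by rewrite mulr0 htau0 addr0.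
rewrite -scalerAr htauZ IHm //.
(* The term in [Q] survives only if [x] is the inverse of [w * s i], but that inverse does not
   descend at [i]. *)
have [wx|_] := eqVneq (w * s i * x)%g 1%g; last by rewrite mulr0 addr0.
by move: u; rewrite -(mulKg (w * s i)%g x) wx mulg1 in dx *; rewrite dx.
Qed.

Lemma hcoef_tau z w : hcoef z w = htau (z * hT Q w^-1%g).
Proof.
elim/hT_span_ind: z => [|z z' E E'|c x].
- by rewrite mul0r htau0 hcoef0.
- by rewrite mulrDl htauD hcoefD E E'.
rewrite -scalerAl htauZ hcoefZ htau_hT2 hcoef_hT.
by rewrite -eq_mulgV1 eq_sym.
Qed.

End Hecke.

(** * Traces are determined by words with distinct letters *)

Section Trace.
Variables (R : comNzRingType) (Q : R) (n : nat).
Local Notation H := (hecke Q n).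
Local Notation T := (hgen Q).
Implicit Types (i j : 'I_n.-1) (x y w : 'S_n) (a b d : seq 'I_n.-1) (z h : H) (k : nat).

Definition hecke_trace (t : H -> R) : Prop :=
  [/\ forall h1 h2, t (h1 + h2) = t h1 + t h2, forall c h, t (c *: h) = c * t h
    & forall h1 h2, t (h1 * h2) = t (h2 * h1)].

Lemma central_trace z : hcentral z -> hecke_trace (fun h => htau (z * h)).
Proof.
move=> zc; split=> [h1 h2|c h|h1 h2].
- by rewrite mulrDr htauD.
- by rewrite -scalerAr htauZ.
by rewrite mulrA htauC mulrA -zc mulrA.
Qed.

(** Generators are numbered from 0: [hsub 0] consists of the scalars and [hsub n.-1] of the whole
    algebra. *)
Inductive hsub k : H -> Prop :=
  | hsub_scal c : hsub k c%:A
  | hsub_gen i : (i < k)%N -> hsub k (T i)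
  | hsub_add h1 h2 : hsub k h1 -> hsub k h2 -> hsub k (h1 + h2)
  | hsub_mul h1 h2 : hsub k h1 -> hsub k h2 -> hsub k (h1 * h2).

Inductive hsub_coset (j : 'I_n.-1) : H -> Prop :=
  | hsub_coset_low h : hsub j h -> hsub_coset j h
  | hsub_coset_mid h1 h2 : hsub j h1 -> hsub j h2 -> hsub_coset j (h1 * T j * h2)
  | hsub_coset_add h1 h2 : hsub_coset j h1 -> hsub_coset j h2 -> hsub_coset j (h1 + h2).

Lemma hsub_comm i h k : hsub k h -> (k < i)%N -> T i * h = h * T i.
Proof.
move=> hk ki; elim: h / hk => [c|j jk|h1 h2 _ E1 _ E2|h1 h2 _ E1 _ E2].
- by rewrite mulr_algl mulr_algr.
- by rewrite -hgen_comm //; lia.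
- by rewrite mulrDl mulrDr E1 E2.
by rewrite mulrA E1 -!mulrA E2.
Qed.

Lemma hsub_word_comm a h k : hsub k h -> all (fun i : 'I_n.-1 => k < i)%N a ->
  hword Q a * h = h * hword Q a.
Proof.
move=> hk; elim: a => [|i a IHa] /=; first by rewrite hword_nil mulr1 mul1r.
by case/andP=> ki /IHa E; rewrite hword_cons -mulrA E !mulrA (hsub_comm hk ki).
Qed.

Lemma hsub_cosetMl j h1 h2 : hsub j h1 -> hsub_coset j h2 -> hsub_coset j (h1 * h2).
Proof.
move=> S1; elim=> [h S|u v Su Sv|u v _ Iu _ Iv].
- exact/hsub_coset_low/hsub_mul.
- by rewrite !mulrA; apply: hsub_coset_mid => //; apply: hsub_mul.
by rewrite mulrDr; apply: hsub_coset_add.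
Qed.

Lemma hsub_cosetMr j h1 h2 : hsub_coset j h1 -> hsub j h2 -> hsub_coset j (h1 * h2).
Proof.
move=> C S2; elim: C => [h S|u v Su Sv|u v _ Iu _ Iv].
- exact/hsub_coset_low/hsub_mul.
- by rewrite -mulrA; apply: hsub_coset_mid => //; apply: hsub_mul.
by rewrite mulrDl; apply: hsub_coset_add.
Qed.

Lemma hsub_coset_quad j z : hsub j z -> T j * z = z * T j -> hsub_coset j (T j * z * T j).
Proof.
move=> S ->; rewrite -mulrA hgen_quad mulrDr mulr1 -scalerAr.
apply: hsub_coset_add; last exact: hsub_coset_low.
have -> : Q *: (z * T j) = (Q%:A * z) * T j * 1%:A.
  by rewrite scale1r mulr1 mulr_algl scalerAl.
by apply: hsub_coset_mid; [apply: hsub_mul => //|]; apply: hsub_scal.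
Qed.

(** The only product that is not visibly of the right form has two factors T_j, and it reduces to
    [T j * z * T j] with [z] in the smaller algebra. *)
Lemma hsub_coset_closed j :
  (forall z, hsub j z -> hsub_coset j (T j * z * T j)) ->
  forall h, hsub j.+1 h -> hsub_coset j h.
Proof.
move=> mid h; elim=> {h} [c|i ik|h1 h2 _ E1 _ E2|h1 h2 _ E1 _ E2].
- exact/hsub_coset_low/hsub_scal.
- have [ij|ij] := ltnP i j; first exact/hsub_coset_low/hsub_gen.
  have -> : i = j by apply: val_inj => /=; lia.
  rewrite -[T j]mul1r -[X in hsub_coset _ X]mulr1 -(scale1r (1 : H)).
  by apply: hsub_coset_mid; apply: hsub_scal.
- exact: hsub_coset_add.
elim: E1 => {h1} [z S|u v Su Sv|u v _ Iu _ Iv].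
- exact: hsub_cosetMl.
- elim: E2 => {h2} [z S|u' v' Su' Sv'|u' v' _ Iu _ Iv].
  + by rewrite -mulrA; apply: hsub_coset_mid => //; apply: hsub_mul.
  + have -> : u * T j * v * (u' * T j * v') = u * (T j * (v * u') * T j) * v'.
      by rewrite !mulrA.
    by apply: hsub_cosetMr => //; apply: hsub_cosetMl => //; apply/mid/hsub_mul.
  by rewrite mulrDr; apply: hsub_coset_add.
by rewrite mulrDl; apply: hsub_coset_add.
Qed.

(** Induction on [k]: the inner element is itself decomposed one level below, where the lower
    factors commute with T_j. *)
Lemma hsub_coset_of k (kn : (k < n.-1)%N) h : hsub k.+1 h -> hsub_coset (Ordinal kn) h.
Proof.
elim: k kn h => [|k IHk] kn h; set j := Ordinal kn; apply: (@hsub_coset_closed j) => z S.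
  apply: hsub_coset_quad => //.
  elim: S => {z} [c|//|h1 h2 _ E1 _ E2|h1 h2 _ E1 _ E2].
  - by rewrite mulr_algl mulr_algr.
  - by rewrite mulrDl mulrDr E1 E2.
  by rewrite mulrA E1 -!mulrA E2.
have kn' : (k < n.-1)%N by rewrite ltnW.
have mono u : hsub k u -> hsub j u.
  move=> Su; elim: Su => {u} [c|i ik|h1 h2 _ E1 _ E2|h1 h2 _ E1 _ E2].
  - exact: hsub_scal.
  - by apply: hsub_gen => /=; lia.
  - exact: hsub_add.
  exact: hsub_mul.
have com u : hsub k u -> T j * u = u * T j by move=> Su; apply: (hsub_comm Su).
elim: (IHk kn' z S) => {z S} [z S|u v Su Sv|u v _ Iu _ Iv].
- by apply: hsub_coset_quad; [apply: mono|apply: com].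
- set i := Ordinal kn'.
  (* Both occurrences of T_j slide past [u] and [v] until the braid relation applies, leaving a
     single T_j. *)
  have -> : T j * (u * T i * v) * T j = u * T i * T j * (T i * v).
    rewrite !mulrA (com _ Su) -!mulrA -(com _ Sv) !mulrA.
    by rewrite -(mulrA u) -(mulrA u) -hgen_braid // !mulrA.
  by apply: hsub_coset_mid; apply: hsub_mul; try exact: mono; apply: hsub_gen.
by rewrite mulrDr mulrDl; apply: hsub_coset_add.
Qed.

Lemma hsub_full h : hsub n.-1 h.
Proof.
elim/hT_span_ind: h => [|h1 h2 S1 S2|c w].
- by rewrite -(scale0r (1 : H)); apply: hsub_scal.
- exact: hsub_add.
rewrite -mulr_algl; apply: hsub_mul; first exact: hsub_scal.
rewrite /hT; elim: (reduced_word w) => [|i a IHa].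
  by rewrite big_nil -(scale1r (1 : H)); apply: hsub_scal.
by rewrite big_cons; apply: hsub_mul => //; apply: hsub_gen.
Qed.

(* Modulo commutators, a T_j b with T_j the top generator becomes T_j b a, so
   that the generators can be peeled off one at a time. *)
Lemma trace_ind_uniq t (P : R -> Prop) : hecke_trace t ->
  (forall c1 c2, P c1 -> P c2 -> P (c1 + c2)) -> (forall c1 c2, P c2 -> P (c1 * c2)) ->
  (forall d, uniq d -> P (t (hword Q d))) -> forall h, P (t h).
Proof.
move=> [tD tZ tC] PD PM Pd h.
(* Here [d] holds the letters already peeled off, all at least [k], and [u] is what remains to be
   decomposed. *)
suff key k d : (k <= n.-1)%N -> uniq d -> all (fun i : 'I_n.-1 => k <= i)%N d ->
    forall u, hsub k u -> P (t (hword Q d * u)).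
  by rewrite -[h]mul1r -(hword_nil Q n); apply: key (hsub_full h).
elim: k d => [|k IHk] d kn ud dk u Su.
  suff [c ->] : exists c, u = c%:A by rewrite mulr_algr tZ; apply/PM/Pd.
  elim: Su => {u} [c|//|h1 h2 _ [c1 ->] _ [c2 ->]|h1 h2 _ [c1 ->] _ [c2 ->]].
  - by exists c.
  - by exists (c1 + c2); rewrite scalerDl.
  - by exists (c1 * c2); rewrite mulr_algl scalerA.
elim: (hsub_coset_of kn Su) => {u Su} [u Su|u v Su Sv|u v _ Iu _ Iv]; first 1 last.
- set j := Ordinal kn.
  have -> : t (hword Q d * (u * T j * v)) = t (hword Q (rcons d j) * (v * u)).
    rewrite -cats1 hword_cat hword_cons hword_nil mulr1.
    have -> : hword Q d * (u * T j * v) = u * (hword Q d * T j * v).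
      by rewrite !mulrA (hsub_word_comm Su).
    by rewrite tC !mulrA.
  apply: IHk; [exact: ltnW| | |exact: hsub_mul].
    rewrite rcons_uniq ud andbT; apply/negP=> /(allP dk) /=; lia.
  rewrite all_rcons /= leqnn; apply: sub_all dk => i; exact: ltnW.
- by rewrite mulrDr tD; apply: PD.
by apply: IHk => //; [exact: ltnW|apply: sub_all dk => i; exact: ltnW].
Qed.

End Trace.

(* Bring the largest remaining letter k of x = u k v to the front: u commutes
   with the letters already placed and with no others, so that d u k v ~ d k v u. *)
Lemma cyclic_word_perm m (X : Type) (f : seq 'I_m -> X) :
  (forall u v, f (u ++ v) = f (v ++ u)) ->
  (forall u v (i j : 'I_m), (i.+1 < j)%N -> f (u ++ i :: j :: v) = f (u ++ j :: i :: v)) ->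
  forall a b, uniq a -> perm_eq a b -> f a = f b.
Proof.
move=> fC fcomm.
have move1 (i : 'I_m) d u v : all (fun j : 'I_m => i.+1 < j)%N d ->
    f (u ++ d ++ i :: v) = f (u ++ i :: d ++ v).
  elim: d u => [//|j d IHd] u /= /andP[ij dj].
  by rewrite -cat_rcons IHd // cat_rcons -fcomm.
have moveS d x u v : all (fun i : 'I_m => all (fun j : 'I_m => i.+1 < j)%N d) x ->
    f (u ++ d ++ x ++ v) = f (u ++ x ++ d ++ v).
  elim: x u => [//|i x IHx] u /= /andP[id xd].
  by rewrite move1 // -cat_rcons IHx // cat_rcons.
have front (d x : seq 'I_m) (k : 'I_m) : uniq x -> k \in x -> all (fun i : 'I_m => i <= k)%N x ->
    all (fun j : 'I_m => k < j)%N d ->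
    exists2 y, perm_eq x (k :: y) & f (d ++ x) = f (rcons d k ++ y).
  move=> ux kx xk kd; case/splitPr: kx ux xk => u v; rewrite uniq_catC /= mem_cat => ux.
  rewrite all_cat /= => /and3P[uk _ vk].
  exists (v ++ u); first by rewrite perm_catC.
  rewrite -[d ++ _]cat0s moveS ?cat0s.
    by rewrite fC -catA cat_rcons.
  (* For [i] in [u] and [j] in [d], distinctness of the letters gives [i < k < j], hence the gap
     needed to commute. *)
  apply/allP=> i iu; have /allP /(_ i iu) ik := uk.
  have {}ik : (i < k)%N.
    rewrite ltn_neqAle ik andbT; apply: contraTneq ux => ikE.
    by rewrite -(val_inj ikE) iu; case: (_ \in v).
  by apply: sub_all kd => j; lia.
move=> a b ua ab; rewrite -[a]cat0s -[b]cat0s.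
(* The invariant, every remaining letter below every placed one, is stated for the empty prefix so
   that this prefix can be generalized to [d]. *)
have : all (fun i : 'I_m => all (fun j : 'I_m => i < j)%N ([::] : seq 'I_m)) a.
  by apply/allP.
move: [::] => d; have [N] := ubnP (size a).
elim: N a b d ua ab => // N IHN a b d ua ab aN ad.
case: a ua ab aN ad => [|a0 a] ua ab aN ad.
  by move/perm_size: (ab); case: b ab.
have [k ka kmax] : exists2 k, k \in a0 :: a & all (fun i : 'I_m => i <= k)%N (a0 :: a).
  case: (@arg_maxnP _ a0 (mem (a0 :: a)) val); first exact: mem_head.
  by move=> k ka kmax; exists k => //; apply/allP.
have kd : all (fun j : 'I_m => k < j)%N d by apply: (allP ad).
have [y1 p1 ->] := front d _ k ua ka kmax kd.
have [|||y2 p2 ->] := front d b k _ _ _ kd.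
- by rewrite -(perm_uniq ab).
- by rewrite -(perm_mem ab).
- by rewrite -(perm_all _ ab).
have p12 : perm_eq y1 y2.
  by rewrite -(perm_cons k) -(permPl p1) (permPl ab).
have uk : uniq (k :: y1) by rewrite -(perm_uniq p1).
apply: IHN => //; first by case/andP: uk.
  by move: aN; rewrite (perm_size p1).
apply/allP=> i iy; rewrite all_rcons.
have ia : i \in a0 :: a by rewrite (perm_mem p1) inE iy orbT.
rewrite (allP ad) // andbT ltn_neqAle (allP kmax) // andbT.
by apply: contraTneq uk => ikE; rewrite -(val_inj ikE) /= iy.
Qed.

(** * Compositions and Coxeter elements of Young subgroups *)

Lemma reshape_index_cons m I i :
  reshape_index (m :: I) i = if (i < m)%N then 0%N else (reshape_index I (i - m)).+1.
Proof.
rewrite /reshape_index /= subn_eq0; case: ltnP => // mi.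
by rewrite subSn.
Qed.

Lemma reshape_index_lt I i : (i < sumn I)%N -> (reshape_index I i < size I)%N.
Proof. exact: reshape_indexP. Qed.

Lemma reshape_index_cat I1 I2 i :
  reshape_index (I1 ++ I2) i =
    if (i < sumn I1)%N then reshape_index I1 i
    else (size I1 + reshape_index I2 (i - sumn I1))%N.
Proof.
elim: I1 i => [|m I1 IH] i /=; first by rewrite subn0.
rewrite !reshape_index_cons; case: (ltnP i m) => im; first by rewrite ltn_addr.
rewrite IH ltn_subLR // subnDA; case: ifP => //.
Qed.

Lemma reshape_index_homo I : {homo reshape_index I : i j / (i <= j)%N}.
Proof.
elim: I => [|m I IH] i j ij; first by [].
rewrite !reshape_index_cons; case: (ltnP i m) => im //.
by rewrite (ltnNge j) (leq_trans im ij) /= ltnS IH // leq_sub2r.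
Qed.

Lemma count_reshape_index I k :
  count (fun i => reshape_index I i == k) (iota 0 (sumn I)) = nth 0%N I k.
Proof.
elim: I k => [|m I IH] k /=; first by rewrite nth_nil.
rewrite iotaD count_cat add0n -[in iota m _](addn0 m) iotaDl count_map.
case: k => [|k] /=.
  rewrite (@eq_in_count _ _ xpredT) => [|i]; last first.
    by rewrite mem_iota reshape_index_cons => /= ->.
  rewrite count_predT size_iota (@eq_in_count _ _ xpred0) ?count_pred0 ?addn0 // => i _ /=.
  by rewrite reshape_index_cons ltnNge leq_addr.
rewrite (@eq_in_count _ _ xpred0) ?count_pred0 => [|i]; last first.
  by rewrite mem_iota reshape_index_cons => /= ->.
rewrite add0n -IH; apply: eq_count => i /=.
by rewrite reshape_index_cons ltnNge leq_addr /= addKn eqSS.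
Qed.

Definition is_composition n I := all (leq 1) I && (sumn I == n).

Lemma partition_composition n (mu : partition_of n) : is_composition n mu.
Proof. by have /and3P[_ ? ?] := partsP mu; apply/andP. Qed.

Lemma perm_composition n I1 I2 : perm_eq I1 I2 -> is_composition n I1 = is_composition n I2.
Proof. by move=> p; rewrite /is_composition (perm_all _ p) (perm_sumn p). Qed.

Lemma sort_composition n I : is_composition n I -> is_partition n (sort geq I).
Proof.
rewrite -(perm_composition n (permEl (perm_sort geq I))) /is_partition => c.
by rewrite [X in _ && X]c andbT; apply: sort_sorted => x y; apply: leq_total.
Qed.

(** For [i < n.-1], the condition that the simple reflection at [i] lies in the Young subgroup of
    [I]. *)
Definition same_block I i := reshape_index I i == reshape_index I i.+1.

(** A block of size m contains m - 1 pairs of neighbours. *)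
Lemma count_same_block I : all (leq 1) I ->
  (count (same_block I) (iota 0 (sumn I).-1) + size I = sumn I)%N.
Proof.
elim: I => [//|[//|m] I IH] /= /IH{}IH; rewrite addSn /=.
rewrite iotaD count_cat add0n (@eq_in_count _ _ xpredT) => [|i]; last first.
  rewrite mem_iota /same_block !reshape_index_cons => /= im.
  by rewrite ltnS (ltnW im) ltnS im.
rewrite count_predT size_iota.
case sI: (sumn I) IH => [|p] /=.
  by case: I sI => [|k I] //=; rewrite ?addn0 ?addn1 //; lia.
move=> <-; rewrite /same_block !reshape_index_cons ltnSn ltnn /= add0n.
rewrite (_ : iota m.+1 p = map (addn m.+1) (iota 0 p)); last by rewrite -iotaDl addn0.
rewrite count_map (@eq_count _ _ (same_block I)); first by rewrite addnA addnS.
move=> i /=; rewrite /same_block !reshape_index_cons ltnNge leq_addr /=.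
by rewrite -addnS ltnNge leq_addr /= !addKn eqSS.
Qed.

(** Subsets of the generators encode compositions: according to [J 0], either the first part grows
    by one or a new part 1 is put in front. *)
Lemma composition_exists n (J : pred nat) : (0 < n)%N ->
  exists2 I, is_composition n I & forall i, (i < n.-1)%N -> same_block I i = J i.
Proof.
case: n => // n _; elim: n J => [|n IH] J; first by exists [:: 1%N].
have [I /andP[I1 /eqP sI] IJ] := IH (fun i => J i.+1).
case: I I1 sI IJ => [|m I] //= /andP[m1 I1] sI IJ.
have [J0|J0] := boolP (J 0%N).
  exists (m.+1 :: I); first by rewrite /is_composition /= I1 addSn sI eqxx.
  move=> i; rewrite /same_block !reshape_index_cons !ltnS.
  case: i => [|i] ilt; first by rewrite m1 J0.
  by rewrite -IJ -1?ltnS // /same_block !reshape_index_cons !subSS //.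
exists [:: 1%N, m & I]; first by rewrite /is_composition /= m1 I1 sI add1n eqxx.
move=> [|i] ilt; rewrite /same_block 2!(reshape_index_cons 1) /=.
  by rewrite (negPf J0).
by rewrite -IJ // /same_block eqSS !subn1.
Qed.

Definition block_swap_fun p q (i : nat) : nat :=
  if (i < p)%N then (i + q)%N else if (i < p + q)%N then (i - p)%N else i.

(** The swap translates each of the three groups of blocks rigidly, and neighbours in one block
    belong to one group. *)
Lemma block_swap_same I1 I2 I3 k (f := block_swap_fun (sumn I1) (sumn I2)) :
  same_block (I1 ++ I2 ++ I3) k -> f k.+1 = (f k).+1 /\ same_block (I2 ++ I1 ++ I3) (f k).
Proof.
rewrite {}/f /same_block !reshape_index_cat /block_swap_fun.
have := @reshape_index_lt I1 k; have := @reshape_index_lt I2 (k - sumn I1).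
move: (sumn I1) (sumn I2) => p q r2 r1.
case: (ltnP k p) => kp.
  case: (ltnP k.+1 p) => kp1 /eqP; last by have := r1 kp; lia.
  move=> E; split; first by lia.
  have -> : (k + q < q)%N = false by lia.
  have -> : ((k + q).+1 < q)%N = false by lia.
  by rewrite -addSn !addnK kp kp1 E.
have -> : (k.+1 < p)%N = false by lia.
case: (ltnP k (p + q)) => kq /eqP/addnI.
  have kq' : (k - p < q)%N by lia.
  rewrite kq'; case: (ltnP k.+1 (p + q)) => kq1; last first.
    have -> : (k.+1 - p < q)%N = false by lia.
    by have := r2 kq'; lia.
  have kq1' : (k.+1 - p < q)%N by lia.
  by rewrite kq1' => E; rewrite -subSn // kq1' E.
have -> : (k - p < q)%N = false by lia.
have -> : (k.+1 - p < q)%N = false by lia.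
move=> /addnI E; split; first by have -> : (k.+1 < p + q)%N = false by lia.
have -> : (k < q)%N = false by lia.
have -> : (k.+1 < q)%N = false by lia.
have -> : (k - q < p)%N = false by lia.
have -> : (k.+1 - q < p)%N = false by lia.
have -> : (k - q - p = k - p - q)%N by lia.
have -> : (k.+1 - q - p = k.+1 - p - q)%N by lia.
by rewrite E.
Qed.

Section CompositionWord.
Variable n : nat.
Implicit Types (i j : 'I_n.-1) (a : seq 'I_n.-1) (I : seq nat).

(** The corresponding product is a Coxeter element of the Young subgroup of [I]. *)
Definition comp_word I : seq 'I_n.-1 := [seq i <- enum 'I_n.-1 | same_block I (i : 'I_n.-1)].

Lemma mem_comp_word I i : (i \in comp_word I) = same_block I i.
Proof. by rewrite mem_filter mem_enum andbT. Qed.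

Lemma comp_word_uniq I : uniq (comp_word I).
Proof. by rewrite filter_uniq ?enum_uniq. Qed.

Lemma size_comp_word I : is_composition n I -> size (comp_word I) = (n - size I)%N.
Proof.
case/andP=> I1 /eqP sI; have := count_same_block I1.
rewrite sI /comp_word size_filter -val_enum_ord count_map => /(canRL (addnK _)) <-.
exact: eq_count.
Qed.

Lemma uniq_comp_word a : (0 < n)%N -> uniq a ->
  exists2 I, is_composition n I & perm_eq a (comp_word I).
Proof.
move=> n0 ua.
have [I cI IE] := composition_exists (fun k => k \in [seq val i | i <- a]) n0.
exists I => //; apply: uniq_perm => //; first exact: comp_word_uniq.
by move=> i; rewrite mem_comp_word IE // mem_map //; apply: val_inj.
Qed.

End CompositionWord.

Section TraceWord.
Variables (R : comNzRingType) (Q : R) (n : nat).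
Local Notation H := (hecke Q n).
Local Notation T := (hgen Q).
Implicit Types (i j : 'I_n.-1) (x y w : 'S_n) (a b : seq 'I_n.-1) (t : H -> R).

Lemma trace_perm_word t a b : hecke_trace t -> uniq a -> perm_eq a b ->
  t (hword Q a) = t (hword Q b).
Proof.
move=> [_ _ tC]; apply: (cyclic_word_perm (f := fun a => t (hword Q a))).
  by move=> u v; rewrite !hword_cat.
by move=> u v i j ij; rewrite !hword_cat !hword_cons !mulrA -!(mulrA (hword Q u)) hgen_comm.
Qed.

(** The quadratic relation makes [T i - Q] the inverse of [T i]. *)
Lemma hT_unit x : exists y : H, y * hT Q x = 1 /\ hT Q x * y = 1.
Proof.
rewrite /hT; elim: (reduced_word x) => [|i a [y [E1 E2]]].
  by exists 1; rewrite big_nil mulr1.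
have quad : T i * T i - Q *: T i = 1 by rewrite hgen_quad addrC addKr.
rewrite big_cons; exists (y * (T i - Q%:A)); split.
  by rewrite !mulrA -(mulrA y) mulrBl mulr_algl quad mulr1.
by rewrite mulrA -(mulrA (T i)) E2 mulr1 mulrBr mulr_algr quad.
Qed.

(** Here [s i * x = x * s j], and the length increases on both sides, so both products are T of this
    permutation. *)
Lemma hT_shift x i j : x (lo i) = lo j -> x (hi i) = hi j -> T i * hT Q x = hT Q x * T j.
Proof.
move=> xl xh; have E : (simple_refl i * x = x * simple_refl j)%g.
  by rewrite (conjgC _ x) !simple_reflE tpermJ xl xh.
have u : ~~ ldescent i x by rewrite /ldescent xl xh /= -leqNgt.
rewrite -(hT_lmul_up Q u) E hT_rmul_up // ldescentV -E -leqNgt.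
by rewrite perm_length_up.
Qed.

Lemma trace_shift_word t x (f : 'I_n.-1 -> 'I_n.-1) a : hecke_trace t ->
  (forall i, i \in a -> x (lo i) = lo (f i) /\ x (hi i) = hi (f i)) ->
  t (hword Q (map f a)) = t (hword Q a).
Proof.
move=> [_ _ tC] xf; have [y [E1 E2]] := hT_unit x.
have E : hword Q a * hT Q x = hT Q x * hword Q (map f a).
  elim: a xf => [|i a IHa] xf; first by rewrite !hword_nil mulr1 mul1r.
  rewrite /= !hword_cons -mulrA IHa => [|j ja]; last by apply: xf; rewrite inE ja orbT.
  by have [xl xh] := xf i (mem_head _ _); rewrite !mulrA (hT_shift xl xh).
by rewrite -[hword Q a]mulr1 -E2 mulrA E -mulrA tC -mulrA E1 mulr1.
Qed.

Lemma trace_comp_catCA t I1 I2 I3 : hecke_trace t -> is_composition n (I1 ++ I2 ++ I3) ->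
  t (hword Q (comp_word n (I1 ++ I2 ++ I3))) = t (hword Q (comp_word n (I2 ++ I1 ++ I3))).
Proof.
move=> tt cI; have cI' : is_composition n (I2 ++ I1 ++ I3).
  by rewrite -(perm_composition n (permEl (perm_catCA I1 I2 I3))).
set p := sumn I1; set q := sumn I2.
have pqn : (p + q <= n)%N.
  by case/andP: cI => _ /eqP <-; rewrite !sumn_cat addnA leq_addr.
pose f := block_swap_fun p q.
have fn (i : 'I_n) : (f i < n)%N.
  by have := ltn_ord i; rewrite /f /block_swap_fun; case: ifP; [|case: ifP]; lia.
have finj : injective (fun i : 'I_n => Ordinal (fn i)).
  move=> i j [] ij; apply: val_inj; move: ij => /=; rewrite /f /block_swap_fun.
  by repeat case: ifP => ?; lia.
pose x := perm finj.
have xE (i : 'I_n) : x i = f i :> nat by rewrite permE.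
(* The default [i] of [insubd] is never reached on letters of the word, by [gf]. *)
pose g (i : 'I_n.-1) : 'I_n.-1 := insubd i (f i).
have blk k (sk : same_block (I1 ++ I2 ++ I3) k) :
  f k.+1 = (f k).+1 /\ same_block (I2 ++ I1 ++ I3) (f k) := block_swap_same sk.
have gf i : i \in comp_word n (I1 ++ I2 ++ I3) -> g i = f i :> nat.
  rewrite mem_comp_word => /blk[f1 _]; rewrite val_insubd ifT //.
  by have := fn (hi i); rewrite /= f1; lia.
have gE i : i \in comp_word n (I1 ++ I2 ++ I3) -> x (lo i) = lo (g i) /\ x (hi i) = hi (g i).
  move=> ia; have := gf i ia; move: ia; rewrite mem_comp_word => /blk[f1 _] gi.
  by split; apply: val_inj; rewrite /= xE /= gi.
have ug : uniq (map g (comp_word n (I1 ++ I2 ++ I3))).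
  rewrite map_inj_in_uniq ?comp_word_uniq // => i j ia ja ij.
  have [[xi _] [xj _]] := (gE i ia, gE j ja).
  by apply/val_inj; have := congr1 val (perm_inj (etrans xi (etrans (congr1 _ ij) (esym xj)))).
have sub : {subset map g (comp_word n (I1 ++ I2 ++ I3)) <= comp_word n (I2 ++ I1 ++ I3)}.
  move=> j /mapP[i ia ->]; rewrite mem_comp_word gf //.
  by move: ia; rewrite mem_comp_word => /blk[].
rewrite -(trace_shift_word tt gE); apply: trace_perm_word => //.
apply: uniq_perm => //; first exact: comp_word_uniq.
(* The shifted word is duplicate-free, contained in the other word and of the same length, so it has
   the same letters. *)
have [|//] := uniq_min_size ug sub.
by rewrite size_map !size_comp_word // !size_cat; lia.
Qed.

Lemma trace_comp_perm t I1 I2 : hecke_trace t -> is_composition n I1 -> perm_eq I1 I2 ->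
  t (hword Q (comp_word n I1)) = t (hword Q (comp_word n I2)).
Proof.
move=> tt c1 p12.
(* The permutation principle quantifies over all lists, hence the value 0 outside the compositions
   of [n]. *)
pose F I := if is_composition n I then t (hword Q (comp_word n I)) else 0.
have : F I1 = F I2.
  apply: catCA_perm_subst p12 => J1 J2 J3; rewrite /F.
  rewrite -(perm_composition n (permEl (perm_catCA J1 J2 J3))).
  by case: ifP => // cJ; apply: trace_comp_catCA.
by rewrite /F c1 -(perm_composition n p12) c1.
Qed.

End TraceWord.

(** * Cycle types *)

Lemma card_ord_count n (P : pred nat) : #|[set y : 'I_n | P y]| = count P (iota 0 n).
Proof. by rewrite cardsE cardE size_filter -val_enum_ord count_map enumT. Qed.

Lemma perm_image_imset (T1 T2 : finType) (rT : eqType) (f : T1 -> T2) (g : T2 -> rT)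
    (A : {set T1}) :
  {in A &, injective f} -> perm_eq [seq g c | c in f @: A] [seq g (f c) | c in A].
Proof.
move=> fi; rewrite [X in perm_eq _ X](map_comp g f); apply: perm_map; apply: uniq_perm.
- exact: enum_uniq.
- by rewrite map_inj_in_uniq ?enum_uniq // => x y; rewrite !mem_enum; apply: fi.
by move=> y; rewrite mem_enum; apply/imsetP/mapP => -[x xA ->]; exists x; rewrite // mem_enum in xA *.
Qed.

Section CycleType.
Variable n : nat.
Implicit Types (i j : 'I_n.-1) (x y w u : 'S_n) (a b : seq 'I_n.-1) (I : seq nat).

Lemma porbit_conj w u (k : 'I_n) : porbit (w ^ u)%g (u k) = u @: porbit w k.
Proof.
apply/setP=> l; apply/porbitP/imsetP => [[m ->]|[_ /porbitP[m ->] ->]].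
  by exists ((w ^+ m)%g k); [apply: mem_porbit|rewrite -conjXg !permM permK].
by exists m; rewrite -conjXg !permM permK.
Qed.

Lemma porbits_conj w u : porbits (w ^ u)%g = [set u @: (c : {set 'I_n}) | c in porbits w].
Proof.
apply/setP=> c; apply/imsetP/imsetP => [[k _ ->]|[_ /imsetP[k _ ->] ->]].
  by exists (porbit w (u^-1 k)%g); rewrite ?imset_f // -porbit_conj permKV.
by exists (u k); rewrite ?porbit_conj.
Qed.

Lemma card_porbits_conj w u : #|porbits (w ^ u)%g| = #|porbits w|.
Proof. by rewrite porbits_conj card_imset //; apply/imset_inj/perm_inj. Qed.

Lemma cycle_type_conj w u : cycle_type (w ^ u)%g = cycle_type w.
Proof.
have tot : total geq by move=> p q; apply: leq_total.
have tr : transitive geq by move=> p q r qp pr; apply: leq_trans pr qp.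
have asym : antisymmetric geq by move=> p q; rewrite andbC => /anti_leq.
apply/(perm_sortP tot tr asym); rewrite porbits_conj.
apply: (perm_trans (perm_image_imset _ _)).
  by move=> c d _ _; apply/imset_inj/perm_inj.
have -> : [seq #|u @: (c : {set 'I_n})| | c in porbits w] =
    [seq #|c| | c : {set 'I_n} in porbits w].
  by apply: eq_map => c; rewrite card_imset //; apply: perm_inj.
exact: perm_refl.
Qed.

Lemma cycle_typeV w : cycle_type w^-1%g = cycle_type w.
Proof. by rewrite /cycle_type porbitsV. Qed.

Lemma card_porbits1 : #|porbits (1%g : 'S_n)| = n.
Proof.
have E (k : 'I_n) : porbit 1%g k = [set k].
  apply/setP=> l; rewrite inE; apply/porbitP/eqP => [[m ->]|->].
    by rewrite expg1n perm1.
  by exists 0%N; rewrite expg0 perm1.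
rewrite card_in_imset ?card_ord // => k l _ _; rewrite !E => /setP/(_ k).
by rewrite !inE eqxx => /esym/eqP.
Qed.

(** Each new letter [i] joins two cycles: the product of the other letters preserves the segment up
    to [i], so it separates [lo i] from [hi i]. *)
Lemma card_porbits_uniq a : uniq a -> (#|porbits (word_prod a)| + size a = n)%N.
Proof.
elim: a => [|i a IHa] /=; first by rewrite word_prod_nil card_porbits1 addn0.
case/andP=> ia /IHa E; rewrite word_prod_cons simple_reflE.
have := porbits_mul_tperm (word_prod a) (lo i) (hi i).
rewrite lo_neq_hi.
have -> : lo i \notin porbit (word_prod a) (hi i).
  apply/negP=> /porbitP[m lE].
  have inv m' (k : 'I_n) : ((word_prod a ^+ m')%g k <= i)%N = (k <= i)%N.
    elim: m' => [|m' IHm']; first by rewrite expg0 perm1.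
    by rewrite expgSr permM word_prod_stable.
  by have := inv m (hi i); rewrite -lE /= leqnn ltnn.
by cbv zeta; have -> : (true.*2 = 2)%N by []; rewrite addn2 addn1 addnS -addSn => -[->].
Qed.

Lemma word_prod_block I a (k : 'I_n) : all (same_block I) [seq val i | i <- a] ->
  reshape_index I (word_prod a k) = reshape_index I k.
Proof.
elim: a k => [|i a IHa] k /=; first by rewrite word_prod_nil perm1.
case/andP=> /eqP si /IHa E; rewrite word_prod_cons permM E.
have [ki|ki] := eqVneq (k : nat) i.
  have -> : k = lo i by apply: val_inj.
  by rewrite simple_refl_lo /= si.
have [kSi|kSi] := eqVneq (k : nat) i.+1.
  have -> : k = hi i by apply: val_inj.
  by rewrite simple_refl_hi /= si.
by rewrite simple_refl_id.
Qed.

Section Blocks.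
Variables (I : seq nat) (cI : is_composition n I) (w : 'S_n).
Hypothesis wI : forall k, reshape_index I (w k) = reshape_index I k.

Let block (j : 'I_(size I)) : {set 'I_n} := [set y : 'I_n | reshape_index I y == j].

Lemma reshape_index_ord (k : 'I_n) : (reshape_index I k < size I)%N.
Proof. by apply: reshape_index_lt; case/andP: cI => _ /eqP->. Qed.

Let blk (k : 'I_n) : 'I_(size I) := Ordinal (reshape_index_ord k).

Lemma blk_surj (j : 'I_(size I)) : exists k, blk k = j.
Proof.
have c0 : (0 < nth 0 I j)%N by case/andP: cI => /allP I1 _; apply/I1/mem_nth.
have kn : (flatten_index I j 0 < n)%N.
  by case/andP: cI => _ /eqP <-; apply: flatten_indexP.
by exists (Ordinal kn); apply: val_inj; rewrite /= flatten_indexKl.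
Qed.

Lemma card_block (j : 'I_(size I)) : #|block j| = nth 0%N I j.
Proof.
by rewrite (card_ord_count n (fun k => reshape_index I k == j)) -count_reshape_index;
  case/andP: cI => _ /eqP->.
Qed.

Lemma block_inj : injective block.
Proof.
move=> j1 j2; have [k <-] := blk_surj j1 => /setP/(_ k); rewrite !inE eqxx => /esym/eqP E.
exact: val_inj.
Qed.

(** The union of the blocks meeting [c]; it maps the orbits of [w] onto the blocks, which yields the
    comparison of their numbers. *)
Let hull (c : {set 'I_n}) : {set 'I_n} :=
  [set y : 'I_n | [exists k in c, reshape_index I y == reshape_index I k]].

Lemma porbit_block k l : l \in porbit w k -> reshape_index I l = reshape_index I k.
Proof.
case/porbitP=> m ->; elim: m => [|m IHm]; first by rewrite expg0 perm1.
by rewrite expgSr permM wI.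
Qed.

Lemma hull_porbit k : hull (porbit w k) = block (blk k).
Proof.
apply/setP=> y; rewrite !inE; apply/exists_inP/eqP => [[l lk /eqP->]|yk].
  exact: porbit_block.
by exists k; rewrite ?porbit_id // yk.
Qed.

Lemma hull_porbits : hull @: porbits w = block @: [set: 'I_(size I)].
Proof.
apply/setP=> c; apply/imsetP/imsetP => [[_ /imsetP[k _ ->] ->]|[j _ ->]].
  by exists (blk k); rewrite ?hull_porbit.
have [k <-] := blk_surj j; exists (porbit w k); rewrite ?imset_f //.
by rewrite hull_porbit.
Qed.

Lemma card_blocks : #|block @: [set: 'I_(size I)]| = size I.
Proof. by rewrite card_imset ?cardsT ?card_ord //; apply: block_inj. Qed.

Lemma leq_card_porbits : (size I <= #|porbits w|)%N.
Proof. by rewrite -card_blocks -hull_porbits leq_imset_card. Qed.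

(** With as many orbits as blocks, the surjection [hull] is injective on orbits, so every orbit
    fills its block. *)
Lemma cycle_type_block : #|porbits w| = size I -> cycle_type w = sort geq I.
Proof.
move=> wI_card.
have hi : {in porbits w &, injective hull}.
  by apply/imset_injP; rewrite hull_porbits card_blocks wI_card.
have pE k : porbit w k = block (blk k).
  apply/setP=> l; rewrite inE; apply/idP/eqP => [/porbit_block //|lk].
  suff <- : porbit w l = porbit w k by apply: porbit_id.
  apply: hi; rewrite ?imset_f // !hull_porbit; congr block; exact: val_inj.
have psE : porbits w = block @: [set: 'I_(size I)].
  apply/setP=> c; apply/imsetP/imsetP => [[k _ ->]|[j _ ->]].
    by exists (blk k).
  by have [k <-] := blk_surj j; exists k.
have tot : total geq by move=> p q; apply: leq_total.
have tr : transitive geq by move=> p q r qp pr; apply: leq_trans pr qp.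
have asym : antisymmetric geq by move=> p q; rewrite andbC => /anti_leq.
apply/(perm_sortP tot tr asym); rewrite psE.
apply: (perm_trans (perm_image_imset _ _)); first by move=> ? ? _ _; apply: block_inj.
have -> : [seq #|block j| | j : 'I_(size I) in [set: 'I_(size I)]] = I.
  rewrite /image_mem (eq_map card_block).
  have -> : enum [set: 'I_(size I)] = enum 'I_(size I) by apply: eq_enum => j; rewrite !inE.
  by rewrite (map_comp (nth 0%N I)) val_enum_ord -/(mkseq _ _) mkseq_nth.
exact: perm_refl.
Qed.

End Blocks.

Lemma all_comp_word a I : perm_eq a (comp_word n I) -> all (same_block I) [seq val i | i <- a].
Proof.
move=> p; apply/allP=> _ /mapP[i ia ->].
by move: ia; rewrite (perm_mem p) mem_comp_word.
Qed.

(** A word with m distinct letters lies in a Young subgroup with n - m blocks, each of which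
    contains an orbit. *)
Lemma card_porbits_word (n0 : (0 < n)%N) a : (n <= #|porbits (word_prod a)| + size (undup a))%N.
Proof.
have [I cI pI] := uniq_comp_word n0 (undup_uniq a).
have wI : all (same_block I) [seq val i | i <- a].
  have /allP H := all_comp_word pI; apply/allP=> k /mapP[i ia ->].
  by apply/H/map_f; rewrite mem_undup.
have := leq_card_porbits cI (fun k => word_prod_block k wI).
rewrite (perm_size pI) size_comp_word //; lia.
Qed.

Lemma cycle_type_comp I a : is_composition n I -> perm_eq a (comp_word n I) ->
  cycle_type (word_prod a) = sort geq I.
Proof.
move=> cI pI; apply: cycle_type_block => // [k|].
  exact/word_prod_block/all_comp_word.
have ua : uniq a by rewrite (perm_uniq pI) comp_word_uniq.
have In : (size I <= n)%N.
  case/andP: cI => I1 /eqP <-; elim: (I) I1 => //= m I' IH /andP[m1 /IH]; lia.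
by have := card_porbits_uniq ua; rewrite (perm_size pI) size_comp_word //; lia.
Qed.

End CycleType.

(** * Central elements and minimal length elements *)

Section MinClass.
Variables (n : nat) (n_gt0 : (0 < n)%N).
Implicit Types (i j : 'I_n.-1) (x y w u : 'S_n) (a b : seq 'I_n.-1).

(** At Q = 0 the algebra is the group algebra of the symmetric group. *)
Lemma hT_mul0 (R : comNzRingType) x y : hT (0 : R) x * hT 0 y = hT 0 (x * y)%g.
Proof.
have [E _] := reduced_wordP x; rewrite {1}/hT -{2}E.
elim: (reduced_word x) => [|i a IHa]; first by rewrite big_nil mul1r word_prod_nil mul1g.
rewrite big_cons word_prod_cons -mulrA IHa -mulgA hT_lmul.
by case: ifP; rewrite ?scale0r addr0.
Qed.

Definition conjugate w x : bool := [exists u, x == (w ^ u)%g].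

Lemma conjugateJ w x u : conjugate w (x ^ u)%g = conjugate w x.
Proof.
apply/existsP/existsP => -[v /eqP xv]; last by exists (v * u)%g; rewrite xv conjgM.
by exists (v * u^-1)%g; rewrite conjgM -xv conjgK.
Qed.

(** On basis elements this is the indicator function of the class, and [x * y] is conjugate to
    [y * x]. *)
Lemma class_trace (R : comNzRingType) w :
  hecke_trace (fun h : hecke (0 : R) n => \sum_(x | conjugate w x) hcoef h x).
Proof.
set t := fun h => _.
have tD h1 h2 : t (h1 + h2) = t h1 + t h2.
  by rewrite -big_split; apply: eq_bigr => x _; rewrite hcoefD.
have tZ c h : t (c *: h) = c * t h.
  by rewrite mulr_sumr; apply: eq_bigr => x _; rewrite hcoefZ.
have tT x : t (hT 0 x) = (conjugate w x)%:R.
  rewrite /t; case: (boolP (conjugate w x)) => xw.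
    rewrite (bigD1 x) //= hcoef_hT eqxx big1 ?addr0 // => y /andP[_ /negPf yx].
    by rewrite hcoef_hT yx.
  rewrite big1 // => y yw; rewrite hcoef_hT.
  by case: eqP => // yx; rewrite -yx yw in xw.
split=> // h1 h2; elim/hT_span_ind: h1 => [|u v E1 E2|c x].
- by rewrite mulr0 mul0r.
- by rewrite mulrDl mulrDr !tD E1 E2.
elim/hT_span_ind: h2 => [|u v E1 E2|d y].
- by rewrite mulr0 mul0r.
- by rewrite mulrDl mulrDr !tD E1 E2.
rewrite -!scalerAl -!scalerAr !tZ !hT_mul0 !tT mulrCA.
by rewrite -(conjugateJ w (x * y) x) conjgE mulgA mulKg.
Qed.

(* At Q = 0 the indicator function of a conjugacy class is a trace, so it
   cannot vanish on all the words with distinct letters. *)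
Lemma conjugate_uniq_word w : exists2 a, uniq a & conjugate w (word_prod a).
Proof.
(* The second alternative does not depend on [c], so [P] has the closure properties of an ideal. *)
pose P (c : int) := c = 0 \/ exists2 a, uniq a & conjugate w (word_prod a).
have tt := @class_trace int w.
have PD c1 c2 : P c1 -> P c2 -> P (c1 + c2).
  by move=> [->|?]; last (by right); move=> [->|?]; [left; rewrite addr0|right].
have PM c1 c2 : P c2 -> P (c1 * c2) by move=> [->|?]; [left; rewrite mulr0|right].
have Pd d : uniq d -> P (\sum_(x | conjugate w x) hcoef (hword 0 d) x).
  move=> ud; case: (boolP (conjugate w (word_prod d))) => wd; first by right; exists d.
  left; rewrite -hT_uniq // big1 // => x wx; rewrite hcoef_hT.
  by case: eqP => // xd; rewrite -xd wx in wd.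
case: (trace_ind_uniq tt PD PM Pd (hT 0 w)) => //.
rewrite (bigD1 w) /=; last by apply/existsP; exists 1%g; rewrite conjg1.
rewrite hcoef_hT eqxx big1 ?addr0 => [/eqP|x /andP[_ /negPf xw]]; first by rewrite oner_eq0.
by rewrite hcoef_hT xw.
Qed.

(** A conjugate has the same number of cycles, so by [card_porbits_word] its reduced words need at
    least [size a] letters. *)
Lemma min_in_class_uniq a : uniq a -> min_in_class (word_prod a).
Proof.
move=> ua; apply/forallP=> u; rewrite perm_length_uniq //.
have [bE <-] := reduced_wordP (word_prod a ^ u)%g.
have := card_porbits_word n_gt0 (reduced_word (word_prod a ^ u)%g).
rewrite bE card_porbits_conj -[X in (X <= _)%N](card_porbits_uniq ua) leq_add2l.
by move=> /leq_trans; apply; apply: size_undup.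
Qed.

(** Being no longer than a conjugate word with distinct letters, a reduced word of [w] has just
    enough letters for its number of cycles, hence no repetition. *)
Lemma min_in_class_reduced w : min_in_class w -> uniq (reduced_word w).
Proof.
move=> wmin; have [wE ws] := reduced_wordP w.
have [a ua /existsP[u /eqP aE]] := conjugate_uniq_word w.
have := forallP wmin u; rewrite -aE perm_length_uniq // -ws => sa.
have := card_porbits_word n_gt0 (reduced_word w); rewrite wE.
have := card_porbits_uniq ua; rewrite aE card_porbits_conj => E.
rewrite -[X in (X <= _)%N]E leq_add2l => H.
apply: contraTT H => nu; rewrite -ltnNge; apply: leq_trans sa.
by rewrite ltn_size_undup.
Qed.

End MinClass.

(** * Values of central elements at partitions *)

Section CentralCoef.
Variables (n : nat) (n_gt0 : (0 < n)%N) (R : comNzRingType) (Q : R).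
Local Notation H := (hecke Q n).
Implicit Types (a b : seq 'I_n.-1) (z h : H) (la mu : partition_of n).

Definition part_word la : seq 'I_n.-1 := comp_word n la.

Lemma trace_uniq_word t a : hecke_trace t -> uniq a ->
  exists2 la : partition_of n, cycle_type (word_prod a) = la
    & t (hword Q a) = t (hword Q (part_word la)).
Proof.
move=> tt ua; have [I cI pI] := uniq_comp_word n_gt0 ua.
exists (PartitionOf (sort_composition cI)); first exact: cycle_type_comp.
rewrite (trace_perm_word tt ua pI); apply: trace_comp_perm => //.
by rewrite perm_sym; apply/permEl/perm_sort.
Qed.

Lemma trace_ind t (P : R -> Prop) : hecke_trace t ->
  (forall c1 c2, P c1 -> P c2 -> P (c1 + c2)) -> (forall c1 c2, P c2 -> P (c1 * c2)) ->
  (forall la, P (t (hword Q (part_word la)))) -> forall h, P (t h).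
Proof.
move=> tt PD PM Pla; apply: trace_ind_uniq => // d ud.
by have [la _ ->] := trace_uniq_word tt ud.
Qed.

(** For central [z], this is the coefficient of [z] at every element of minimal length in the class
    of cycle type [la]. *)
Definition central_value z la : R := htau (z * hword Q (part_word la)).

(** [P] plays the role of an ideal: the zero ideal gives uniqueness, the multiples of a scalar give
    divisibility. *)
Lemma hcoef_central_ind (P : R -> Prop) z : hcentral z ->
  (forall c1 c2, P c1 -> P c2 -> P (c1 + c2)) -> (forall c1 c2, P c2 -> P (c1 * c2)) ->
  (forall la, P (central_value z la)) -> forall w, P (hcoef z w).
Proof.
move=> zc PD PM Pla w; rewrite hcoef_tau.
exact: (trace_ind (central_trace zc) PD PM Pla).
Qed.

Lemma central_eq z1 z2 : hcentral z1 -> hcentral z2 ->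
  central_value z1 =1 central_value z2 -> z1 = z2.
Proof.
move=> c1 c2 E; apply/eqP; rewrite -subr_eq0; apply/eqP/hcoef_inj => w; rewrite hcoef0.
apply: (@hcoef_central_ind (fun c => c = 0)).
- by move=> h; rewrite mulrBl mulrBr c1 c2.
- by move=> d1 d2 -> ->; rewrite addr0.
- by move=> d1 d2 ->; rewrite mulr0.
by move=> la; rewrite /central_value mulrBl -scaleN1r htauD htauZ [htau (z1 * _)]E mulN1r subrr.
Qed.

(** The dual of T_w is T of the inverse of w; here the inverse is the reversed word, again with
    distinct letters and of the same cycle type. *)
Lemma hcoef_central_uniq z a la : hcentral z -> uniq a ->
  cycle_type (word_prod a) = la -> hcoef z (word_prod a) = central_value z la.
Proof.
move=> zc ua aE; rewrite hcoef_tau -word_prod_rev hT_uniq ?rev_uniq //.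
have [|mu mE E] := trace_uniq_word (central_trace zc) (a := rev a); first by rewrite rev_uniq.
rewrite E; congr central_value; apply: val_inj; rewrite /= -mE.
by rewrite word_prod_rev cycle_typeV aE.
Qed.

Lemma cycle_type_part_word la : cycle_type (word_prod (part_word la)) = la.
Proof.
rewrite (cycle_type_comp (partition_composition la)); last exact: perm_refl.
apply: sorted_sort; first by move=> p q r qp pr; apply: leq_trans pr qp.
by case/and3P: (partsP la).
Qed.

Lemma part_word_uniq la : uniq (part_word la).
Proof. exact: comp_word_uniq. Qed.

Lemma size_part_word la : size (part_word la) = (n - size la)%N.
Proof. exact/size_comp_word/partition_composition. Qed.

Lemma central_valueE z la : hcentral z -> central_value z la = hcoef z (word_prod (part_word la)).
Proof.
by move=> zc; rewrite (hcoef_central_uniq zc (part_word_uniq la) (cycle_type_part_word la)).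
Qed.

Lemma hcoef_central_min z w : hcentral z -> min_in_class w ->
  exists2 la : partition_of n, cycle_type w = la & hcoef z w = central_value z la.
Proof.
move=> zc /(min_in_class_reduced n_gt0) uw; have [wE _] := reduced_wordP w.
have [la laE _] := trace_uniq_word (central_trace zc) uw.
by exists la; [rewrite -laE wE|rewrite -[in LHS]wE (hcoef_central_uniq zc uw laE)].
Qed.

End CentralCoef.

(** * The normalization map *)

Section MinCosetRep.
Variables (n : nat) (I : seq nat).
Implicit Types (i j : 'I_n.-1) (x y w u v : 'S_n).

Lemma simple_refl_young j : same_block I j -> simple_refl j \in young n I.
Proof.
move=> sj; rewrite inE; apply/forallP=> k.
have := @word_prod_block n I [:: j] k; rewrite word_prod_cons word_prod_nil mulg1 => -> //.
by rewrite /= sj.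
Qed.

Lemma block_monotone v (k l : 'I_n) : (forall j, same_block I j -> ~~ ldescent j v) ->
  reshape_index I k = reshape_index I l -> (k < l)%N -> (v k < v l)%N.
Proof.
move=> up kl kltl; apply: (@adjacent_trans n nat ltn (fun k => v k : nat)) => //.
  by move=> a b c; apply: ltn_trans.
move=> j kj jl; have /up : same_block I j.
  rewrite /same_block eqn_leq reshape_index_homo //=.
  by apply: leq_trans (reshape_index_homo I kj); rewrite kl; apply: reshape_index_homo.
by rewrite ldescentN.
Qed.

Lemma reshape_index_ltP (k l : nat) : (reshape_index I k < reshape_index I l)%N -> (k < l)%N.
Proof. by rewrite !ltnNge; apply: contra; apply: reshape_index_homo. Qed.

(** The inverse of [w] increases on each block, so an inversion of [w] takes its values in two
    distinct blocks, whose order [u] does not affect. *)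
Lemma inversions_young w u : (forall j, same_block I j -> ~~ ldescent j w^-1%g) ->
  u \in young n I -> inversions w \subset inversions (w * u)%g.
Proof.
move=> up; rewrite inE => /forallP uI; apply/subsetP=> -[k l]; rewrite !inE /= !permM.
case/andP=> kl wlk; rewrite kl /=; apply: reshape_index_ltP.
rewrite (eqP (uI _)) (eqP (uI _)) ltn_neqAle reshape_index_homo ?(ltnW wlk) // andbT.
apply/eqP=> E; have := block_monotone up E wlk.
by rewrite !permK ltnNge (ltnW kl).
Qed.

Lemma min_coset_repP w :
  reflect (forall j, same_block I j -> ~~ ldescent j w^-1%g) (min_coset_rep I w).
Proof.
apply: (iffP forall_inP) => [wmin j sj|up u uI]; last first.
  by rewrite !perm_lengthE subset_leq_card // inversions_young.
by rewrite ldescentV -leqNgt; apply/wmin/simple_refl_young.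
Qed.

Lemma simple_refl_swap i (k l : 'I_n) :
  (k < l)%N -> (simple_refl i l < simple_refl i k)%N -> k = lo i /\ l = hi i.
Proof.
move=> kl.
have [ki|ki] := eqVneq (k : nat) i; last have [kSi|kSi] := eqVneq (k : nat) i.+1.
- have -> : k = lo i by apply: val_inj.
  rewrite simple_refl_lo; have [lE|lE] := eqVneq (l : nat) i.+1.
    by move=> _; split=> //; apply: val_inj.
  by rewrite simple_refl_id //=; lia.
- have -> : k = hi i by apply: val_inj.
  by rewrite simple_refl_hi simple_refl_id //=; lia.
rewrite (simple_refl_id ki kSi).
have [li|li] := eqVneq (l : nat) i; last have [lSi|lSi] := eqVneq (l : nat) i.+1.
- have -> : l = lo i by apply: val_inj.
  by rewrite simple_refl_lo /=; lia.
- have -> : l = hi i by apply: val_inj.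
  by rewrite simple_refl_hi /=; lia.
by rewrite simple_refl_id //; lia.
Qed.

(** A descent of the inverse of [s i * w] inside a block comes from a pair which [s i] inverts, and
    its only inversion is [(lo i, hi i)]. *)
Lemma min_coset_rep_lmul w i : min_coset_rep I w -> ~~ min_coset_rep I (simple_refl i * w)%g ->
  exists2 j, w (lo i) = lo j & w (hi i) = hi j.
Proof.
move=> /min_coset_repP up nD.
have [j sj d] : exists2 j : 'I_n.-1, same_block I j & ldescent j (simple_refl i * w)^-1%g.
  pose P (j : 'I_n.-1) := same_block I j && ldescent j (simple_refl i * w)^-1%g.
  case: (boolP [exists j, P j]) => [/existsP[j /andP[]]|]; first by exists j.
  rewrite negb_exists => /forallP nP; case/negP: nD; apply/min_coset_repP => j sj.
  by have := nP j; rewrite /P sj.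
move: (up j sj) d; rewrite ldescentN invMg simple_reflV /ldescent !permM => a b.
by have [El Eh] := simple_refl_swap a b; exists j; rewrite -?El -?Eh permKV.
Qed.

End MinCosetRep.

Section Normalization.
Variables (R : comNzRingType) (Q : R) (n : nat).
Local Notation H := (hecke Q n).
Local Notation T := (hgen Q).
Implicit Types (i j : 'I_n.-1) (x y w u v : 'S_n) (z h : H).

Lemma hcentral_gen z : (forall i, z * T i = T i * z) -> hcentral z.
Proof.
move=> zT h; elim/hT_span_ind: h => [|h1 h2 E1 E2|c w].
- by rewrite mulr0 mul0r.
- by rewrite mulrDr mulrDl E1 E2.
rewrite -scalerAl -scalerAr; congr (_ *: _); rewrite /hT.
elim: (reduced_word w) => [|i a IHa]; first by rewrite big_nil mulr1 mul1r.
by rewrite big_cons mulrA zT -mulrA IHa mulrA.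
Qed.

Let X w : H := hT Q w * hT Q w^-1%g.

Lemma normalization1E I : normalization I (1 : H) = \sum_(w | min_coset_rep I w) X w.
Proof. by apply: eq_bigr => w _; rewrite mulr1. Qed.

(** [X (s i * w)] is [T i * X w * T i]; after expanding the squares of T_i, both sides contain the
    same terms. *)
Lemma norm_pair_comm i w : ~~ ldescent i w ->
  T i * (X w + X (simple_refl i * w)%g) = (X w + X (simple_refl i * w)%g) * T i.
Proof.
move=> u; have -> : X (simple_refl i * w)%g = T i * X w * T i.
  rewrite /X invMg simple_reflV (hT_lmul_up Q u) hT_rmul_up ?invgK //.
  by rewrite !mulrA.
rewrite mulrDr mulrDl !mulrA hgen_quad -(mulrA _ (T i) (T i)) hgen_quad.
rewrite !mulrDl !mulrDr !mul1r !mulr1 -!scalerAl -!scalerAr.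
by rewrite /X addrCA [RHS]addrCA; congr (_ + _); apply: addrC.
Qed.

Lemma norm_shift_comm i j w : w (lo i) = lo j -> w (hi i) = hi j -> T i * X w = X w * T i.
Proof.
move=> wl wh; rewrite /X mulrA (hT_shift Q wl wh) -!mulrA; congr (_ * _).
by apply: hT_shift; rewrite -?wl -?wh permK.
Qed.

(* Deodhar's lemma: for w a minimal coset representative, either s_i w is one too,
   or s_i w = w s_j for a generator s_j of the Young subgroup. *)
Lemma normalization_central I : hcentral (normalization I (1 : H)).
Proof.
apply: hcentral_gen => i; rewrite normalization1E.
pose D := min_coset_rep (n := n) I; pose sw w := (simple_refl i * w)%g.
have swK : involutive sw by move=> w; apply: mulsKg.
rewrite (bigID (fun w => D (sw w))) /= mulrDl mulrDr; congr (_ + _); last first.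
  rewrite mulr_suml mulr_sumr; apply: eq_bigr => w /andP[Dw nDw].
  by have [j wl wh] := min_coset_rep_lmul Dw nDw; rewrite (norm_shift_comm wl wh).
(* The remaining representatives form pairs exchanged by [s i], each indexed by its member without
   descent at [i]. *)
rewrite (bigID (ldescent i)) /= (reindex_inj (inv_inj swK)) /=.
have -> : \sum_(w | min_coset_rep I (sw w) && D (sw (sw w)) && ldescent i (sw w)) X (sw w) =
    \sum_(w | min_coset_rep I w && D (sw w) && ~~ ldescent i w) X (sw w).
  by apply: eq_bigl => w; rewrite swK ldescent_mul [D w && _]andbC.
rewrite -big_split mulr_suml mulr_sumr /=; apply: eq_bigr => w /andP[_ u].
by rewrite addrC norm_pair_comm.
Qed.

(* Left multiplication by generators other than T_i keeps y x^-1 in the stabilizer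
   of the initial segment [0, i], to which s_i does not belong. *)
Lemma hcoef_stable i d x y : i \notin d ->
  ~~ [forall u : 'I_n, ((y * x^-1)%g u <= i)%N == (u <= i)%N] -> hcoef (hword Q d * hT Q x) y = 0.
Proof.
elim: d y => [|j d IHd] y.
  move=> _; rewrite hword_nil mul1r hcoef_hT; case: eqP => // ->.
  by rewrite mulgV => /negP[]; apply/forallP=> u; rewrite perm1.
rewrite inE negb_or => /andP[ij id] ns; rewrite hword_cons -mulrA hcoef_lmul.
rewrite (IHd y) // mulr0 if_same addr0; apply: IHd => //.
apply: contra ns => /forallP st; apply/forallP=> u; apply/eqP.
have := eqP (st (simple_refl j u)); rewrite -mulgA (permM (simple_refl j)) simple_reflK => ->.
have := @word_prod_stable n i [:: j] u; rewrite word_prod_cons word_prod_nil mulg1 => -> //.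
by rewrite inE.
Qed.

(** Of the two terms of [hcoef_lmul], the one at [s i * x] vanishes by [hcoef_stable]; a letter thus
    contributes [Q] at a descent and 0 otherwise. *)
Lemma hcoef_hword_diag d x : uniq d ->
  hcoef (hword Q d * hT Q x) x = if all (fun i => ldescent i x) d then Q ^+ size d else 0.
Proof.
elim: d => [|i d IHd] /=; first by rewrite hword_nil mul1r hcoef_hT eqxx expr0.
case/andP=> id ud; rewrite hword_cons -mulrA hcoef_lmul (@hcoef_stable i) //; last first.
  apply/negP=> /forallP /(_ (lo i)); rewrite -mulgA mulgV mulg1 simple_refl_lo /=.
  by rewrite leqnn ltnn.
by rewrite add0r IHd //; case: (ldescent i x) => //=; case: ifP => _; rewrite ?mulr0 // exprS.
Qed.

(** By cyclicity and duality, the summand of [w] is the coefficient of T_w in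
    [hword Q d * hT Q w]. *)
Lemma normalization_value I d : uniq d ->
  htau (normalization I (1 : H) * hword Q d) =
  Q ^+ size d *+ #|[set w : 'S_n | min_coset_rep I w & all (fun i => ldescent i w) d]|.
Proof.
move=> ud; rewrite normalization1E mulr_suml /htau hcoef_sum -/(htau _).
transitivity (\sum_(w : 'S_n | min_coset_rep I w && all (fun i => ldescent i w) d) Q ^+ size d).
  rewrite big_mkcondr /=; apply: eq_bigr => w _.
  by rewrite -hcoef_hword_diag // [RHS]hcoef_tau -[LHS]/(htau _) htauC /X mulrA.
by rewrite sumr_const cardsE.
Qed.

End Normalization.

(** * Counting descending coset representatives *)

Section Counting.
Variables (n : nat) (I J : seq nat) (sI : sumn I = n) (sJ : sumn J = n).
Hypothesis sizeJ : (size J <= n)%N.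
Implicit Types (i j : 'I_n) (x w u v : 'S_n).

Let lt_blockI i : (reshape_index I i < size I)%N.
Proof. by apply: reshape_index_lt; rewrite sI. Qed.

(** The J-blocks are numbered in ['I_n], to match the n variables of the symmetric polynomials. *)
Let lt_blockJ i : (reshape_index J i < n)%N.
Proof. by apply: leq_trans sizeJ; apply: reshape_index_lt; rewrite sJ. Qed.

Definition descending_reps : {set 'S_n} :=
  [set w : 'S_n | min_coset_rep I w & all (fun i : 'I_n.-1 => ldescent i w) (comp_word n J)].

(** A descent of [x] cannot stay inside an I-block, where the inverse of [x] increases. So a J-block
    meets each I-block at most once, and the matrix has entries 0 and 1. *)
Lemma descending_reps_block x i i' : x \in descending_reps ->
  reshape_index J i = reshape_index J i' -> (i < i')%N ->
  (reshape_index I (x i') < reshape_index I (x i))%N.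
Proof.
rewrite inE => /andP[/min_coset_repP up /allP dn] ii' lii'.
apply: (@adjacent_trans n nat gtn (fun k => reshape_index I (x k))) => //.
  by move=> a b c /= ab bc; apply: ltn_trans bc ab.
move=> j ij ji'; have sj : same_block J j.
  rewrite /same_block eqn_leq reshape_index_homo //=.
  by apply: leq_trans (reshape_index_homo J ij); rewrite ii'; apply: reshape_index_homo.
have := dn j; rewrite mem_comp_word => /(_ sj); rewrite /ldescent => d /=.
rewrite ltn_neqAle reshape_index_homo ?(ltnW d) // andbT; apply/eqP => E.
by have := block_monotone up E d; rewrite !permK /= ltnNge leqnSn.
Qed.

(* A set-valued encoding of 0-1 matrices: the row k is the set of the J-blocks that
   x maps partly into the I-block k. *)
Definition incidence x : {ffun 'I_(size I) -> {set 'I_n}} :=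
  [ffun k : 'I_(size I) => [set j : 'I_n | [exists i : 'I_n,
     (reshape_index J i == j) && (reshape_index I (x i) == k)]]].

Lemma card_incidence x (k : 'I_(size I)) : x \in descending_reps ->
  #|incidence x k| = nth 0%N I k.
Proof.
move=> xC; pose f i := Ordinal (lt_blockJ i).
have -> : incidence x k = f @: (x @^-1: [set y : 'I_n | reshape_index I y == k]).
  apply/setP=> j; rewrite ffunE inE; apply/existsP/imsetP.
    by case=> i /andP[/eqP ij ik]; exists i; [rewrite !inE|apply: val_inj].
  by case=> i; rewrite !inE => ik ->; exists i; rewrite ik /= eqxx.
rewrite card_in_imset.
  rewrite card_preimset; last exact: perm_inj.
  by rewrite (card_ord_count n (fun y => reshape_index I y == k)) -sI count_reshape_index.
move=> i i'; rewrite !inE => /eqP ik /eqP ik' /(congr1 val) /= ii'.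
case: (ltngtP i i') => [lii'|lii'|/val_inj //].
  by have := descending_reps_block xC ii' lii'; rewrite ik ik' ltnn.
by have := descending_reps_block xC (esym ii') lii'; rewrite ik ik' ltnn.
Qed.

Lemma sum_incidence x j : x \in descending_reps ->
  (\sum_k (j \in incidence x k) = nth 0 J j)%N.
Proof.
move=> xC; pose f i := Ordinal (lt_blockI (x i)).
have -> : (\sum_k (j \in incidence x k) = #|f @: [set i : 'I_n | reshape_index J i == j]|)%N.
  rewrite -[RHS]sum1_card [RHS]big_mkcond /=; apply: eq_bigr => k _; rewrite ffunE inE.
  suff -> : [exists i : 'I_n, (reshape_index J i == j) && (reshape_index I (x i) == k)] =
     (k \in f @: [set i : 'I_n | reshape_index J i == j]) by case: ifP.
  apply/existsP/imsetP.
    by case=> i /andP[ij /eqP ik]; exists i; rewrite ?inE //; apply: val_inj.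
  by case=> i; rewrite !inE => ij ->; exists i; rewrite ij /=.
rewrite card_in_imset.
  rewrite (card_ord_count n (fun y => reshape_index J y == j)) -[X in iota 0 X]sJ.
  exact: count_reshape_index.
move=> i i'; rewrite !inE => /eqP ij /eqP ij' /(congr1 val) /= ii'.
have E : reshape_index J i = reshape_index J i' by rewrite ij ij'.
case: (ltngtP i i') => [lii'|lii'|/val_inj //].
  by have := descending_reps_block xC E lii'; rewrite ii' ltnn.
by have := descending_reps_block xC (esym E) lii'; rewrite ii' ltnn.
Qed.

(** Some [i'] in the J-block of [i] is sent by [x'] to the I-block of [x i]. It cannot precede [i],
    where [x] and [x'] agree, and from [i] on the I-blocks of [x'] decrease. *)
Lemma incidence_leq x x' i : x \in descending_reps -> x' \in descending_reps ->
  incidence x = incidence x' ->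
  (forall i', (i' < i)%N -> reshape_index I (x i') = reshape_index I (x' i')) ->
  (reshape_index I (x i) <= reshape_index I (x' i))%N.
Proof.
move=> xC x'C E IH.
have : Ordinal (lt_blockJ i) \in incidence x (Ordinal (lt_blockI (x i))).
  by rewrite ffunE inE; apply/existsP; exists i; rewrite !eqxx.
rewrite E ffunE inE => /existsP[i' /andP[/eqP /= ij /eqP /= ik]].
rewrite -ik; case: (ltngtP i i') => [lii'|lii'|/val_inj-> //].
  exact/ltnW/descending_reps_block.
by have := descending_reps_block xC ij lii'; rewrite (IH i') // ik ltnn.
Qed.

(** The two elements lie in the same coset, so by minimality each inversion set contains the
    other. *)
Lemma coset_rep_inj x x' : min_coset_rep I x -> min_coset_rep I x' ->
  (forall i, reshape_index I (x i) = reshape_index I (x' i)) -> x = x'.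
Proof.
have sub (y y' : 'S_n) : min_coset_rep I y ->
    (forall i, reshape_index I (y i) = reshape_index I (y' i)) ->
    inversions y \subset inversions y'.
  move=> /min_coset_repP up E; rewrite -[y'](mulKVg y); apply: (@inversions_young n I) => //.
  by rewrite inE; apply/forallP=> i; rewrite permM -E permKV.
move=> xm xm' E; apply/inversions_inj/eqP; rewrite eqEsubset.
by apply/andP; split; apply: sub.
Qed.

Lemma incidence_inj : {in descending_reps &, injective incidence}.
Proof.
move=> x x' xC x'C E; apply: coset_rep_inj.
- by move: xC; rewrite inE => /andP[].
- by move: x'C; rewrite inE => /andP[].
move=> i; have [m] := ubnP i; elim: m i => // m IHm i im.
have IH i' : (i' < i)%N -> reshape_index I (x i') = reshape_index I (x' i').
  by move=> i'i; apply: IHm; apply: leq_trans i'i im.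
apply/eqP; rewrite eqn_leq !incidence_leq // => i' i'i; exact/esym/IH.
Qed.

Lemma youngM u v : u \in young n I -> v \in young n I -> (u * v)%g \in young n I.
Proof.
rewrite !inE => /forallP uI /forallP vI; apply/forallP=> i.
by rewrite permM (eqP (vI _)).
Qed.

(** Any permutation realizing [b] can be replaced by a shortest element of its coset, which keeps
    the block numbers. *)
Lemma word_coset_rep (b : seq nat) : perm_eq b (mkseq (reshape_index I) n) ->
  exists2 x, min_coset_rep I x & forall i, reshape_index I (x i) = nth 0%N b i.
Proof.
move=> pb; have /tuple_permP[p pE] : perm_eq b [tuple reshape_index I i | i < n].
  by rewrite (permPl pb) /mkseq -val_enum_ord -map_comp.
have pI i : reshape_index I (p i) = nth 0%N b i.
  by rewrite pE -tnth_nth !tnth_mktuple.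
have id_young : (1%g : 'S_n) \in young n I by rewrite inE; apply/forallP=> i; rewrite perm1.
case: (@arg_minnP _ (1%g : 'S_n) (mem (young n I)) (fun u => perm_length (p * u)%g) id_young).
move=> u uI umin; exists (p * u)%g.
  by apply/forall_inP=> v vI; rewrite -mulgA; apply/umin/youngM.
by move=> i; rewrite permM -pI; move: uI; rewrite /= inE => /forallP/(_ (p i))/eqP.
Qed.

Lemma incidence_surj (A : {ffun 'I_(size I) -> {set 'I_n}}) :
  (forall k, #|A k| = nth 0%N I k) -> (forall j, (\sum_k (j \in A k) = nth 0 J j)%N) ->
  exists2 x, x \in descending_reps & incidence x = A.
Proof.
move=> rowA colA.
pose Ab (j k : nat) := [exists k' : 'I_(size I), (k' == k :> nat) &&
   [exists j' in A k', j' == j :> nat]].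
have AbE j (k : 'I_(size I)) : Ab j k = (j \in A k).
  apply/existsP/idP => [[k' /andP[/eqP/val_inj-> /exists_inP[j' jA /eqP/val_inj<- //]]]|jA].
  by exists k; rewrite eqxx; apply/exists_inP; exists j.
(* The rows of a column are listed downwards, so that concatenating the columns gives block numbers
   decreasing along each J-block. *)
pose col (j : nat) := [seq k <- rev (iota 0 (size I)) | Ab j k].
have col_sorted (j : nat) : sorted gtn (col j).
  apply: sorted_filter; first by move=> a b c /= ab bc; apply: ltn_trans bc ab.
  by rewrite rev_sorted; apply: iota_ltn_sorted.
pose cols := mkseq col (size J).
have shapeE : shape cols = J.
  rewrite /shape -map_comp -[RHS](mkseq_nth 0%N).
  apply/eq_in_map => j; rewrite mem_iota add0n /= => jJ.
  have jn : (j < n)%N by apply: leq_trans sizeJ.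
  rewrite -(colA (Ordinal jn)) size_filter count_rev -val_enum_ord count_map.
  rewrite -sum1_count big_enum_cond.
  by rewrite big_mkcond /=; apply: eq_bigr => k _; rewrite -AbE; case: ifP.
pose b := flatten cols.
have bmem i : nth 0%N b i \in col (reshape_index J i).
  have iJ : (reshape_index J i < size J)%N by apply: reshape_index_lt; rewrite sJ.
  rewrite nth_flatten shapeE nth_mkseq //.
  apply: mem_nth; have := @reshape_offsetP J i; rewrite sJ => /(_ (ltn_ord i)).
  by rewrite -{2}shapeE (nth_map [::]) ?size_mkseq ?nth_mkseq.
(* The row sums of [A] say that [b] contains each I-block number as often as it should. *)
have [|x xm xb] := @word_coset_rep b.
  apply/allP=> k _ /=; apply/eqP.
  have -> : count_mem k (mkseq (reshape_index I) n) = nth 0%N I k.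
    by rewrite count_map -[X in iota 0 X]sI -count_reshape_index; apply: eq_count.
  rewrite count_flatten sumnE !big_map.
  have [kI|kI] := ltnP k (size I); last first.
    rewrite nth_default // big1 // => j _; apply/count_memPn; rewrite mem_filter mem_rev mem_iota.
    by rewrite add0n ltnNge kI !andbF.
  have countE (j : nat) : count_mem k (col j) = Ab j k.
    rewrite count_uniq_mem; first by rewrite mem_filter mem_rev mem_iota add0n kI /= andbT.
    by rewrite filter_uniq // rev_uniq iota_uniq.
  under eq_bigr => j _ do rewrite countE.
  rewrite -[X in iota 0 X]subn0 -/(index_iota 0 (size J)).
  have -> : nth 0%N I k = (\sum_(0 <= j < n) Ab j k)%N.
    rewrite -(rowA (Ordinal kI)) -sum1_card big_mkcond big_mkord /=; apply: eq_bigr => j _.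
    by rewrite -(AbE j (Ordinal kI)) /=; case: (Ab j k).
  rewrite [RHS](big_cat_nat _ sizeJ) //=.
  rewrite [X in (_ = _ + X)%N]big_nat [X in (_ = _ + X)%N]big1 ?addn0 // => j /andP[Jj jn].
  have := colA (Ordinal jn); rewrite nth_default // => /eqP; rewrite sum_nat_eq0.
  by move=> /forallP/(_ (Ordinal kI)); rewrite -AbE /=; case: (Ab j k).
have xC : x \in descending_reps.
  rewrite inE xm /=; apply/allP=> j; rewrite mem_comp_word => /eqP sj.
  apply: (@reshape_index_ltP I); rewrite !xb /= !nth_flatten shapeE -sj.
  have jJ : (reshape_index J j < size J)%N.
    by apply: reshape_index_lt; rewrite sJ; apply: (ltn_ord (lo j)).
  rewrite nth_mkseq //.
  have offE : reshape_offset J j.+1 = (reshape_offset J j).+1.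
    by have := reshape_indexK J j; rewrite /flatten_index /reshape_offset -sj; lia.
  have offlt : (reshape_offset J j.+1 < size (col (reshape_index J j)))%N.
    have := @reshape_offsetP J j.+1; rewrite sJ -sj => /(_ (ltn_ord (hi j))).
    by rewrite -{2}shapeE (nth_map [::]) ?size_mkseq ?nth_mkseq.
  apply: (sorted_ltn_nth _ 0%N (col_sorted (reshape_index J j))); rewrite ?inE //.
  - by move=> a c d /= ac cd; apply: ltn_trans cd ac.
  - by move: offlt; rewrite offE; apply: ltnW.
  by rewrite offE.
exists x => //; apply/ffunP=> k; apply/eqP; rewrite eqEcard rowA card_incidence // leqnn andbT.
apply/subsetP=> j; rewrite ffunE inE => /existsP[i /andP[/eqP ij /eqP ik]].
by rewrite -AbE -ij -ik xb; have := bmem i; rewrite mem_filter => /andP[].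
Qed.

Lemma card_descending_reps :
  #|descending_reps| = #|[set A : {ffun 'I_(size I) -> {set 'I_n}} |
    [forall k, #|A k| == nth 0%N I k] && [forall j, (\sum_k (j \in A k) == nth 0 J j)%N]]|.
Proof.
rewrite -(card_in_imset incidence_inj); apply: eq_card => A; rewrite inE.
apply/imsetP/andP => [[x xC ->]|[/forallP rA /forallP cA]].
  split; apply/forallP => k; first by rewrite card_incidence.
  by rewrite sum_incidence.
have [||x xC <-] := @incidence_surj A; last by exists x.
- by move=> k; apply/eqP.
- by move=> j; apply/eqP.
Qed.

End Counting.

(** * The entries of E2M as numbers of 0-1 matrices *)

Lemma E2M_coeff n (la mu : partition_of n) : E2M la mu = (elementary_prod la)@_(partition_mnm mu).
Proof.
rewrite (E2MP la) raddf_sum /= (bigD1 mu) //= mcoeffZ mcoeff_monomial_sym exponents_mnm eqxx mulr1.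
rewrite big1 ?addr0 // => nu numu; rewrite mcoeffZ mcoeff_monomial_sym exponents_mnm.
by rewrite -[_ == _]/(mu == nu) eq_sym (negPf numu) mulr0.
Qed.

(** Expanding the product selects, in the k-th factor, a set [A k] of variables of size the k-th
    part. *)
Lemma mcoeff_elementary_prod n (la : partition_of n) (m : 'X_{1..n}) :
  (elementary_prod la)@_m = #|[set A : {ffun 'I_(size la) -> {set 'I_n}} |
    [forall k, #|A k| == nth 0%N la k] && [forall j, (\sum_k (j \in A k) == m j)%N]]|%:R.
Proof.
rewrite /elementary_prod (big_nth 0%N) big_mkord.
under eq_bigr => k _ do rewrite mesymE.
rewrite bigA_distr_big_dep raddf_sum /=.
under eq_bigr => A _ do rewrite mprodXE mcoeffX.
rewrite -sum1_card natr_sum big_mkcond [RHS]big_mkcond /=; apply: eq_bigr => A _.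
set fam := (A \in family _); rewrite inE.
have -> : fam = [forall k, #|A k| == nth 0%N la k] by apply/familyP/forallP => H k; apply: H.
case: ifP => //= _.
have -> : ((\sum_k mesym1 (A k))%MM == m) = [forall j, (\sum_k (j \in A k) == m j)%N].
  apply/eqP/forallP => [<- j|H].
    by rewrite mnm_sumE; apply/eqP/eq_bigr => k _; rewrite mnmE.
  apply/mnmP=> j; rewrite mnm_sumE -(eqP (H j)); apply: eq_bigr => k _; by rewrite mnmE.
by case: ifP.
Qed.

Lemma E2M_descending_reps n (la mu : partition_of n) :
  E2M la mu = #|descending_reps n la mu|%:R.
Proof.
have sum_part (nu : partition_of n) : sumn nu = n by case/and3P: (partsP nu) => _ _ /eqP.
rewrite E2M_coeff mcoeff_elementary_prod card_descending_reps ?size_partition //.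
congr (_%:R); apply: eq_card => A; rewrite !inE; congr (_ && _).
by apply: eq_forallb => j; rewrite mnmE.
Qed.

(** * Invertibility of E2M *)

Section HeckeMap.
Variables (R S : comNzRingType) (f : {rmorphism R -> S}) (Q : R) (Q' : S) (n : nat).
Hypothesis fQ : f Q = Q'.
Local Notation F := (@hmap R S f Q Q' n).

Lemma hmap_morph : [/\ {morph F : x y / x + y}, {morph F : x y / x * y},
  forall a, F a%:A = (f a)%:A & forall i, F (hgen Q i) = hgen Q' i].
Proof.
by apply: (snd (hlift_unique _ _)) => //; rewrite fQ; apply: hgen_relations.
Qed.

Lemma hmapD : {morph F : x y / x + y}. Proof. by case: hmap_morph. Qed.
Lemma hmapM : {morph F : x y / x * y}. Proof. by case: hmap_morph. Qed.
Lemma hmap_scal a : F a%:A = (f a)%:A. Proof. by case: hmap_morph. Qed.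
Lemma hmap_gen i : F (hgen Q i) = hgen Q' i. Proof. by case: hmap_morph. Qed.

Lemma hmap0 : F 0 = 0.
Proof. by rewrite -(scale0r (1 : hecke Q n)) hmap_scal rmorph0 scale0r. Qed.

Lemma hmap1 : F 1 = 1.
Proof. by rewrite -(scale1r (1 : hecke Q n)) hmap_scal rmorph1 scale1r. Qed.

Lemma hmapZ a z : F (a *: z) = f a *: F z.
Proof. by rewrite -mulr_algl hmapM hmap_scal mulr_algl. Qed.

Lemma hmap_hT w : F (hT Q w) = hT Q' w.
Proof.
rewrite /hT; elim: (reduced_word w) => [|i a IHa]; first by rewrite !big_nil hmap1.
by rewrite !big_cons hmapM hmap_gen IHa.
Qed.

Lemma hcoef_hmap z w : hcoef (F z) w = f (hcoef z w).
Proof.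
elim/hT_span_ind: z => [|z1 z2 E1 E2|a x].
- by rewrite hmap0 !hcoef0 rmorph0.
- by rewrite hmapD !hcoefD E1 E2 rmorphD.
by rewrite hmapZ !hcoefZ hmap_hT !hcoef_hT rmorphM rmorph_nat.
Qed.

Lemma hmap_central z : hcentral z -> hcentral (F z).
Proof. by move=> zc; apply: hcentral_gen => i; rewrite -hmap_gen -!hmapM zc. Qed.

Lemma central_value_hmap z la : hcentral z -> (0 < n)%N ->
  central_value (F z) la = f (central_value z la).
Proof.
move=> zc n0; rewrite !central_valueE // ?hcoef_hmap //.
exact: hmap_central.
Qed.

End HeckeMap.

Section CentralValueLinear.
Variables (R : comNzRingType) (Q : R) (n : nat).
Implicit Types (z : hecke Q n) (la mu : partition_of n).

Lemma central_valueZ c z la : central_value (c *: z) la = c * central_value z la.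
Proof. by rewrite /central_value -scalerAl htauZ. Qed.

Lemma central_value_sum (I : Type) (r : seq I) (F : I -> hecke Q n) la :
  central_value (\sum_(k <- r) F k) la = \sum_(k <- r) central_value (F k) la.
Proof. by rewrite /central_value mulr_suml /htau hcoef_sum. Qed.

Lemma hcentral_sum (I : Type) (r : seq I) (c : I -> R) (F : I -> hecke Q n) :
  (forall k, hcentral (F k)) -> hcentral (\sum_(k <- r) c k *: F k).
Proof.
move=> Fc h; rewrite mulr_suml mulr_sumr; apply: eq_bigr => k _.
by rewrite -scalerAl -scalerAr Fc.
Qed.

Lemma central_value_normalization la mu :
  central_value (normalization la (1 : hecke Q n)) mu = (E2M la mu)%:~R * Q ^+ (n - size mu).
Proof.
rewrite /central_value normalization_value ?part_word_uniq // size_part_word.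
by rewrite E2M_descending_reps rmorph_nat mulr_natl.
Qed.

Lemma hcoef_class_sum la w : hcoef (class_sum Q la) w = (cycle_type w == la)%:R.
Proof.
rewrite /class_sum hcoef_sum; case: eqP => [wla|wla].
  rewrite (bigD1 w) ?wla //= hcoef_hT eqxx big1 ?addr0 // => x /andP[_ xw].
  by rewrite hcoef_hT eq_sym (negPf xw).
by rewrite big1 // => x /eqP xla; rewrite hcoef_hT; case: eqP wla => // -> [].
Qed.

End CentralValueLinear.

Section E2MInvertible.
Variable n : nat.
Implicit Types (la mu : partition_of n).
Local Notation N := #|{: partition_of n}|.

Definition E2M_mx : 'M[int]_N := \matrix_(i, j) E2M (enum_val i) (enum_val j).

(** The exponents of the product indexed by [la] as a monomial in the elementary symmetric
    polynomials; index [i] stands for degree [i.+1]. *)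
Definition multiplicities la : 'X_{1..n} := [multinom count_mem i.+1 (parts la) | i < n].

Lemma multiplicities_inj : injective multiplicities.
Proof.
move=> la mu E; apply: val_inj => /=.
have [/and3P[sl pl _] /and3P[sm pm _]] := (partsP la, partsP mu).
have gt : transitive geq by move=> y x z /= xy yz; apply: leq_trans yz xy.
have ga : antisymmetric geq by move=> x y; rewrite andbC => /anti_leq.
apply: (sorted_eq gt ga sl sm); apply/allP=> k _ /=; apply/eqP.
have out (nu : partition_of n) : k \notin parts nu -> count_mem k nu = 0%N by move/count_memPn.
case: k out => [|k] out.
  by rewrite !out //; apply/negP; [move=> /(allP pm)|move=> /(allP pl)].
have [kn|kn] := ltnP k n.
  by have := congr1 (fun m : 'X_{1..n} => m (Ordinal kn)) E; rewrite !mnmE.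
by rewrite !out //; apply/negP => /part_le; rewrite ltnNge kn.
Qed.

Lemma elementary_prodE la :
  elementary_prod la = 'X_[multiplicities la] \mPo [tuple mesym n int i.+1 | i < n].
Proof.
rewrite comp_mpolyX /elementary_prod.
transitivity (\prod_(k <- la) \prod_(i < n | i.+1 == k) mesym n int i.+1).
  rewrite !big_seq; apply: eq_bigr => k kla.
  have kn := part_le kla; have k0 : (0 < k)%N by have /and3P[_ /allP/(_ k kla)] := partsP la.
  have kn' : (k.-1 < n)%N by rewrite prednK.
  rewrite (big_pred1 (Ordinal kn')) /= ?prednK // => i.
  by case: k k0 {kla kn} kn' => // k _ kn'; rewrite eqSS -val_eqE.
rewrite (exchange_big_dep xpredT) //=; apply: eq_bigr => i _.
rewrite tnth_mktuple mnmE big_const_seq.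
rewrite (@eq_count _ _ (pred1 i.+1)) => [|k]; last by rewrite /= eq_sym.
by elim: (count _ _) => //= m ->; rewrite exprS.
Qed.

(** A vector of the left kernel gives a relation between distinct monomials in the elementary
    symmetric polynomials, which are algebraically independent. *)
Lemma det_E2M_neq0 : \det E2M_mx != 0.
Proof.
apply/negP=> /det0P[v v0 vM]; case/eqP: v0; apply/rowP=> i; rewrite mxE.
pose t : {mpoly int[n]} := \sum_(la : partition_of n) v 0 (enum_rank la) *: 'X_[multiplicities la].
have t0 : t = 0.
  apply: msym_fundamental_un0; rewrite raddf_sum /=.
  transitivity (\sum_mu (\sum_la v 0 (enum_rank la) * E2M la mu) *: monomial_sym mu).
    under eq_bigr => la _ do rewrite comp_mpolyZ -elementary_prodE E2MP scaler_sumr.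
    rewrite exchange_big /=; apply: eq_bigr => mu _; rewrite scaler_suml.
    by apply: eq_bigr => la _; rewrite scalerA.
  rewrite big1 // => mu _; suff -> : \sum_la v 0 (enum_rank la) * E2M la mu = 0 by rewrite scale0r.
  have := congr1 (fun A : 'rV_N => A 0 (enum_rank mu)) vM; rewrite !mxE => {2}<-.
  rewrite [RHS](reindex (@enum_rank _)) /=; last exact/onW_bij/enum_rank_bij.
  by apply: eq_bigr => la _; rewrite mxE !enum_rankK.
have := congr1 (fun p => p@_(multiplicities (enum_val i))) t0; rewrite mcoeff0 /t raddf_sum /=.
rewrite (bigD1 (enum_val i)) //= mcoeffZ mcoeffX eqxx mulr1 enum_valK big1 ?addr0 // => la lai.
by rewrite mcoeffZ mcoeffX (inj_eq multiplicities_inj) (negPf lai) mulr0.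
Qed.

End E2MInvertible.

(** * The Geck-Rouquier basis *)

(** [B] is the adjugate of E2M and [d] its determinant, reindexed by partitions. *)
Lemma E2M_adjoint n : exists (B : partition_of n -> partition_of n -> int) (d : int),
  [/\ d != 0, forall mu nu, \sum_la B mu la * E2M la nu = d * (mu == nu)%:R
    & forall mu nu, \sum_la E2M mu la * B la nu = d * (mu == nu)%:R].
Proof.
pose N := #|{: partition_of n}|; pose M := E2M_mx n.
exists (fun mu la => (\adj M) (enum_rank mu) (enum_rank la)), (\det M).
have sum_rank (F : 'I_N -> int) : \sum_j F j = \sum_la F (enum_rank la).
  by rewrite (reindex (@enum_rank _)) //; apply/onW_bij/enum_rank_bij.
split=> [|mu nu|mu nu]; first exact: det_E2M_neq0.
  have := congr1 (fun A : 'M_N => A (enum_rank mu) (enum_rank nu)) (mul_adj_mx M).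
  rewrite [LHS]mxE [RHS]mxE (inj_eq enum_rank_inj) mulr_natr sum_rank => <-.
  by apply: eq_bigr => la _; rewrite [M _ _]mxE !enum_rankK.
have := congr1 (fun A : 'M_N => A (enum_rank mu) (enum_rank nu)) (mul_mx_adj M).
rewrite [LHS]mxE [RHS]mxE (inj_eq enum_rank_inj) mulr_natr sum_rank => <-.
by apply: eq_bigr => la _; rewrite [M _ _]mxE !enum_rankK.
Qed.

Section GeckRouquier.
Variables (n : nat) (n_gt0 : (0 < n)%N).
Implicit Types (la mu nu : partition_of n).
Local Notation HX := (hecke ('X : {poly int}) n).

(* [\sum_la B mu la *: N_la(1)] takes the value [d 'X^(n - l(mu))] on mu and
   vanishes on the other partitions, so all its coefficients are divisible by
   that scalar. *)
Lemma dual_central_exists mu : exists2 g : HX, hcentral g &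
  forall nu, central_value g nu = (mu == nu)%:R.
Proof.
have [B [d [d0 BE _]]] := E2M_adjoint n.
pose z : HX := \sum_la (B mu la)%:~R *: normalization la (1 : HX).
(* [{poly int}] is an integral domain, so this nonzero scalar can be cancelled below. *)
pose D : {poly int} := d%:~R * 'X ^+ (n - size mu).
have D0 : D != 0.
  by rewrite mulf_neq0 ?expf_neq0 ?polyX_eq0 // -(rmorph_int polyC) polyC_eq0 intz.
have zc : hcentral z by apply: hcentral_sum => la; apply: normalization_central.
have zE nu : central_value z nu = D * (mu == nu)%:R.
  rewrite central_value_sum.
  under eq_bigr => la _ do rewrite central_valueZ central_value_normalization mulrA -intrM.
  rewrite -mulr_suml -rmorph_sum BE rmorphM rmorph_nat -/D.
  by case: eqVneq => [<-|_]; rewrite ?mulr1 // !mulr0 mul0r.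
have [c cE] : exists c : 'S_n -> {poly int}, forall w, hcoef z w = D * c w.
  apply: (@fin_all_exists _ _ (fun w p => hcoef z w = D * p)) => w.
  apply: (@hcoef_central_ind n n_gt0 _ _ (fun p => exists q, p = D * q) z zc).
  - by move=> _ _ [q1 ->] [q2 ->]; exists (q1 + q2); rewrite mulrDr.
  - by move=> p _ [q ->]; exists (p * q); rewrite mulrCA.
  by move=> nu; exists (mu == nu)%:R; apply: zE.
pose g : HX := \sum_w c w *: hT 'X w.
have gE : D *: g = z.
  by rewrite [z]hcoefE scaler_sumr; apply: eq_bigr => w _; rewrite scalerA cE.
exists g => [h|nu].
  apply/eqP; rewrite -subr_eq0; apply/eqP/hcoef_inj => w; rewrite hcoef0.
  apply: (mulfI D0); rewrite mulr0 -hcoefZ scalerBr scalerAl scalerAr gE zc.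
  by rewrite subrr hcoef0.
by apply: (mulfI D0); rewrite -central_valueZ gE.
Qed.

(** The dual central element and the class sum have the same coefficients on minimal length
    elements. At Q = 0 coefficients of central elements are class functions, so they agree
    everywhere. *)
Lemma geck_rouquier_exists mu : exists g : HX, is_geck_rouquier mu g.
Proof.
have [g gc gE] := dual_central_exists mu.
exists g; split=> //.
  pose f : {rmorphism {poly int} -> int} := horner_eval (0 : int).
  have fX : f 'X = 0 by rewrite /f /= /horner_eval hornerX.
  have gc0 := hmap_central fX gc.
  rewrite -[LHS]/(hmap f 0 g); apply: hcoef_inj => w; rewrite hcoef_class_sum.
  (* At Q = 0 the T_w multiply as permutations, so the trace property is invariance under
     conjugation. *)
  have coefJ u x : hcoef (hmap f (0 : int) g) (x ^ u)%g = hcoef (hmap f (0 : int) g) x.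
    have [_ _ tC] := central_trace gc0.
    by rewrite !hcoef_tau conjgE !invMg invgK -!hT_mul0 tC !hT_mul0 mulgA mulgV mul1g.
  have [a ua /existsP[u /eqP aE]] := conjugate_uniq_word w.
  have [la laE _] := trace_uniq_word n_gt0 (central_trace gc0) ua.
  rewrite -(coefJ u) -aE (hcoef_central_uniq n_gt0 gc0 ua laE) central_value_hmap //.
  by rewrite gE rmorph_nat -(cycle_type_conj w u) -aE laE eq_sym.
exists (fun w => hcoef (g - class_sum 'X mu) w); split; first exact: hcoefE.
move=> w wmin; have [la laE E] := hcoef_central_min n_gt0 gc wmin.
by rewrite hcoefB E gE hcoef_class_sum laE eq_sym subrr.
Qed.

Lemma geck_rouquier_genericP mu : is_geck_rouquier mu (geck_rouquier_generic mu).
Proof.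
apply: (@classical_sets.xgetPex _ 0 (is_geck_rouquier mu)); exact: geck_rouquier_exists.
Qed.

(** Only the defining conditions are used: the word of [nu] has minimal length in its class, so its
    coefficient is that of the class sum. *)
Lemma geck_rouquier_generic_value mu nu :
  central_value (geck_rouquier_generic mu) nu = (mu == nu)%:R.
Proof.
have [gc _ [c [gE cmin]]] := geck_rouquier_genericP mu.
rewrite central_valueE //; set w := word_prod _.
have wmin : min_in_class w by apply/min_in_class_uniq/part_word_uniq.
have := congr1 (fun h => hcoef h w) gE; rewrite hcoefB hcoef_class_sum hcoef_sum.
rewrite big1 => [/eqP|x _]; last first.
  rewrite hcoefZ hcoef_hT; case: eqP => [<-|_]; last by rewrite mulr0.
  by rewrite cmin // mul0r.
by rewrite subr_eq0 => /eqP->; rewrite cycle_type_part_word eq_sym.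
Qed.

Lemma geck_rouquier_central_value (K : comNzRingType) (Q : K) mu :
  hcentral (geck_rouquier Q mu) /\
  forall nu, central_value (geck_rouquier Q mu) nu = (mu == nu)%:R.
Proof.
have [gc _ _] := geck_rouquier_genericP mu.
pose f : {rmorphism {poly int} -> K} := horner_eval Q \o map_poly intr.
have fX : f 'X = Q by rewrite /f /= /horner_eval map_polyX hornerX.
rewrite /geck_rouquier -[hmap _ _ _]/(hmap f Q (geck_rouquier_generic mu)).
split; first exact: hmap_central.
by move=> nu; rewrite central_value_hmap // geck_rouquier_generic_value rmorph_nat.
Qed.

End GeckRouquier.

Theorem theorem7 (n : nat) (n_gt0 : (0 < n)%N)
    (K : comUnitRingType) (q : K) (q_unit : q \is a GRing.unit)
    (Q : K) (QE : Q = q - q^-1) (Q_unit : Q \is a GRing.unit)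
    (iota : {rmorphism rat -> K}) :
  basis_of_submodule (fun z : hecke Q n => hcentral z)
    (fun la : partition_of n => normalization (parts la) (1 : hecke Q n)) /\
  (forall la : partition_of n,
     normalization (parts la) (1 : hecke Q n) =
     \sum_(mu : partition_of n)
       ((E2M la mu)%:~R * Q ^+ (n - size (parts mu))) *: geck_rouquier Q mu).
Proof.
have Nc (la : partition_of n) : hcentral (normalization la (1 : hecke Q n)).
  exact: normalization_central.
split; last first.
  (* Both sides are central and are compared at each [mu], where only the term of index [mu] of the
     sum is nonzero. *)
  move=> la; apply: (central_eq n_gt0) => // [|mu].
    by apply: hcentral_sum => mu; have [] := geck_rouquier_central_value n_gt0 Q mu.
  rewrite central_value_normalization central_value_sum (bigD1 mu) //= central_valueZ.
  rewrite (geck_rouquier_central_value n_gt0 Q mu).2 eqxx mulr1 big1 ?addr0 // => nu numu.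
  by rewrite central_valueZ (geck_rouquier_central_value n_gt0 Q nu).2 (negPf numu) mulr0.
split=> // z zc.
have [B [d [d0 BE EB]]] := E2M_adjoint n.
have dU : (d%:~R : K) \is a GRing.unit.
  by rewrite -(rmorph_int iota) rmorph_unit // unitfE intr_eq0.
have QU k : Q ^+ k \is a GRing.unit by rewrite unitrX.
have valE (c : {ffun partition_of n -> K}) mu :
    central_value (\sum_la c la *: normalization la (1 : hecke Q n)) mu =
    (\sum_la c la * (E2M la mu)%:~R) * Q ^+ (n - size mu).
  rewrite central_value_sum mulr_suml; apply: eq_bigr => la _.
  by rewrite central_valueZ central_value_normalization mulrA.
pose y mu := central_value z mu / Q ^+ (n - size mu).
(* The values of [z], freed of the powers of [Q], form the row vector [y]; the coordinates solve
   [c * E2M = y] by the adjugate. *)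
pose c : {ffun partition_of n -> K} := [ffun la => (\sum_mu y mu * (B mu la)%:~R) / d%:~R].
exists c; split.
  apply: (central_eq n_gt0) => // [|mu]; first exact: hcentral_sum.
  rewrite valE -[LHS](divrK (QU (n - size mu)%N)) -/(y mu); congr (_ * _).
  transitivity ((\sum_nu y nu * (\sum_la B nu la * E2M la mu)%:~R) / d%:~R).
    rewrite (bigD1 mu) //= BE eqxx mulr1 big1 ?addr0 ?mulrK // => nu numu.
    by rewrite BE (negPf numu) mulr0 mulr0.
  under eq_bigr => nu _ do rewrite rmorph_sum mulr_sumr.
  rewrite exchange_big /= mulr_suml; apply: eq_bigr => la _; rewrite ffunE mulrAC; congr (_ / _).
  by rewrite mulr_suml; apply: eq_bigr => nu _; rewrite rmorphM mulrA.
(* Uniqueness comes from multiplying the same system by [B] on the right, which returns [d * c']. *)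
move=> c' zE; apply/ffunP=> la; rewrite ffunE; apply: (canLR (mulrK dU)).
have yE mu : y mu = \sum_nu c' nu * (E2M nu mu)%:~R.
  by rewrite /y zE valE mulrK.
under eq_bigr => mu _ do rewrite yE mulr_suml.
rewrite exchange_big /= (bigD1 la) //=.
have sumE nu : \sum_mu c' nu * (E2M nu mu)%:~R * (B mu la)%:~R = c' nu * (d * (nu == la)%:R)%:~R.
  rewrite -EB rmorph_sum mulr_sumr; apply: eq_bigr => mu _.
  by rewrite rmorphM mulrA.
rewrite sumE eqxx mulr1 big1 ?addr0 // => nu nula.
by rewrite sumE (negPf nula) mulr0 mulr0.
Qed.
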